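(* Let $\mathbf A\in\mathbb R^{I\times R}$, $\mathbf B\in\mathbb R^{J\times R}$, $\mathbf C\in\mathbb R^{K\times R}$, let $\mathcal T=[\mathbf A,\mathbf B,\mathbf C]_R\in\mathbb R^{I\times J\times K}$ and let $m:=R-r_{\mathbf C}+2$. Suppose that $k_{\mathbf C}=r_{\mathbf C}$ and that the matrix $\mathcal C_m(\mathbf A)\odot\mathcal C_m(\mathbf B)$ has full column rank. Then (i) $r_{\mathcal T}=R$ and the CPD of $\mathcal T$ is unique; (ii) the CPD of $\mathcal T$ can be found algebraically.
   Context: All matrices and tensors are real. For $\mathbf A=[\mathbf a_1\cdots\mathbf a_R]\in\mathbb R^{I\times R}$, $\mathbf B=[\mathbf b_1\cdots\mathbf b_R]\in\mathbb R^{J\times R}$, $\mathbf C=[\mathbf c_1\cdots\mathbf c_R]\in\mathbb R^{K\times R}$, $[\mathbf A,\mathbf B,\mathbf C]_R:=\sum_{r=1}^R\mathbf a_r\circ\mathbf b_r\circ\mathbf c_r$, where $(\mathbf a\circ\mathbf b\circ\mathbf c)_{ijk}=a_ib_jc_k$; for nonzero $\mathbf a,\mathbf b,\mathbf c$ this is a rank-1 tensor. The rank $r_{\mathcal T}$ of a tensor $\mathcal T$ is the minimal number of rank-1 tensors whose sum is $\mathcal T$; a decomposition of $\mathcal T$ into $r_{\mathcal T}$ rank-1 terms is a Canonical Polyadic Decomposition (CPD). The CPD is unique if it is unique up to permuting the rank-1 terms and rescaling the vectors inside a rank-1 term while keeping the term unchanged. $r_{\mathbf M}$ is the rank of a matrix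 $\mathbf M$; $k_{\mathbf M}$ (the $k$-rank) is the largest number such that every subset of $k_{\mathbf M}$ columns of $\mathbf M$ is linearly independent. For $k\le\min(p,q)$, the $k$-th compound matrix $\mathcal C_k(\mathbf M)$ of $\mathbf M\in\mathbb R^{p\times q}$ is the $\binom pk\times\binom qk$ matrix of all $k\times k$ minors of $\mathbf M$, with row and column index sets in lexicographic order; a hypothesis involving $\mathcal C_k(\mathbf M)$ presupposes that it is defined. $\odot$ is the Khatri-Rao (column-wise Kronecker) product: $\mathbf X\odot\mathbf Y=[\mathbf x_1\otimes\mathbf y_1\ \cdots\ \mathbf x_N\otimes\mathbf y_N]$. A matrix with $N$ columns has full column rank if its rank is $N$. ''The CPD can be found algebraically'' means: there is a procedure that is guaranteed to find the (exact) decomposition from $\mathcal T$ and relies only on standard linear algebra, namely basic operations on matrices (including solving linear systems and matrix factorizations), computing compound matrices, taking the orthogonal complement of a subspace, and computing generalized eigenvalue decompositions of matrix pencils; taking random (generic) linear combinations of slices is allowed. *)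

(* Defs.v *)
From HB Require Import structures.
From mathcomp Require Import all_boot all_order all_fingroup all_algebra.
From mathcomp Require Import reals mxtens mpoly.

Set Implicit Arguments.
Unset Strict Implicit.
Unset Printing Implicit Defensive.

Import Order.TTheory GRing.Theory Num.Theory.
Local Open Scope ring_scope.

Section Matrices.
Variable F : fieldType.

(* Only k <= q is considered: for k > q there is no k-subset of columns. *)
Definition krank p q (M : 'M[F]_(p, q)) : nat :=
  \max_(k < q.+1 | [forall S : {set 'I_q}, (#|S| == k) ==>
      (\rank (colsub (@enum_val _ (mem S)) M) == k)]) k.

Definition khatri_rao p q n (X : 'M[F]_(p, n)) (Y : 'M[F]_(q, n)) :
    'M[F]_(p * q, n) :=
  \matrix_(i, j) (X (mxtens_unindex i).1 j * Y (mxtens_unindex i).2 j).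

(* A k-subset of 'I_p is represented by its increasing enumeration.  The
   explicit sort is needed because the order of enum on tuples is opaque. *)
Definition ksubsets k p : seq (k.-tuple 'I_p) :=
  sort (<=%O : rel (k.-tuplelexi 'I_p))
       (enum [set t : k.-tuple 'I_p | sorted ltn [seq val i | i <- t]]).

Lemma size_ksubsets k p : size (ksubsets k p) == 'C(p, k).
Proof. by rewrite size_sort -cardE card_ltn_sorted_tuples. Qed.

Definition ksubset k p (i : 'I_('C(p, k))) : k.-tuple 'I_p :=
  tnth (Tuple (size_ksubsets k p)) i.

(* For k > minn p q this is an empty matrix. *)
Definition compound k p q (M : 'M[F]_(p, q)) : 'M[F]_('C(p, k), 'C(q, k)) :=
  \matrix_(i, j) \det (mxsub (tnth (ksubset i)) (tnth (ksubset j)) M).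

End Matrices.

Section Tensors.
Variables (F : realType) (I J K : nat).

Definition tensor := {ffun 'I_I * 'I_J * 'I_K -> F}.

Definition outer (a : 'cV[F]_I) (b : 'cV[F]_J) (c : 'cV[F]_K) : tensor :=
  [ffun x => a x.1.1 0 * b x.1.2 0 * c x.2 0].

Definition rank1 (T : tensor) : Prop :=
  exists a b c, [/\ a != 0, b != 0, c != 0 & T = outer a b c].

Definition sum_of_rank1 (T : tensor) (n : nat) : Prop :=
  exists2 Y : 'I_n -> tensor, (forall r, rank1 (Y r)) & T = \sum_r Y r.

Definition has_rank (T : tensor) (n : nat) : Prop :=
  sum_of_rank1 T n /\ forall n', sum_of_rank1 T n' -> (n <= n')%N.

Definition polyadic n (A : 'M[F]_(I, n)) (B : 'M[F]_(J, n)) (C : 'M[F]_(K, n))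
    : tensor :=
  \sum_r outer (col r A) (col r B) (col r C).

Definition is_cpd (T : tensor) n
    (A : 'M[F]_(I, n)) (B : 'M[F]_(J, n)) (C : 'M[F]_(K, n)) : Prop :=
  [/\ has_rank T n,
      forall r, rank1 (outer (col r A) (col r B) (col r C))
    & T = polyadic A B C].

Definition cpd_unique (T : tensor) : Prop :=
  forall n (A A' : 'M[F]_(I, n)) (B B' : 'M[F]_(J, n)) (C C' : 'M[F]_(K, n)),
    is_cpd T A B C -> is_cpd T A' B' C' ->
    exists (s : 'S_n) (a b c : 'I_n -> F),
      forall r, [/\ a r * b r * c r = 1,
                    col r A' = a r *: col (s r) A,
                    col r B' = b r *: col (s r) B
                  & col r C' = c r *: col (s r) C].

(* The matrix whose columns are the vectorized frontal slices; the unfolding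
   of polyadic A B C is khatri_rao A B *m C^T. *)
Definition unfolding (T : tensor) : 'M[F]_(I * J, K) :=
  \matrix_(i, k) T ((mxtens_unindex i).1, (mxtens_unindex i).2, k).

End Tensors.

(* Linear algebra procedures.

   A procedure is a finite first-order program over matrix registers.  A
   register is identified by a number together with a format m x n, so that
   expressions are typed by their format.  The only constants are rational
   matrices, so the data can enter a computation only through the registers. *)

Inductive expr : nat -> nat -> Type :=
| Reg (x m n : nat) : expr m n
| Const m n (M : 'M[rat]_(m, n)) : expr m n
| Add m n (e1 e2 : expr m n) : expr m n
| Opp m n (e : expr m n) : expr m n
| Scale m n (a : expr 1 1) (e : expr m n) : expr m n
| Mul m n p (e1 : expr m n) (e2 : expr n p) : expr m p
| RowMx m n1 n2 (e1 : expr m n1) (e2 : expr m n2) : expr m (n1 + n2)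
| ColMx m1 m2 n (e1 : expr m1 n) (e2 : expr m2 n) : expr (m1 + m2) n
(* rearrangement of entries: transposition, submatrices, reshaping, slices *)
| Gather m n p q (f : 'I_p -> 'I_q -> 'I_m * 'I_n) (e : expr m n) : expr p q
| Kronecker m n p q (e1 : expr m n) (e2 : expr p q) : expr (m * p) (n * q)
| KhatriRao p q n (e1 : expr p n) (e2 : expr q n) : expr (p * q) n
| Compound k m n (e : expr m n) : expr 'C(m, k) 'C(n, k).

(* In each instruction the leading numbers x, y, z are target registers. *)
Inductive instr : Type :=
| Assign (x : nat) m n (e : expr m n)
| CheckZero m n (e : expr m n)
| Solve (x : nat) m n p (M : expr m n) (B : expr m p)
| OrthComplement (x : nat) m n (d : nat) (M : expr m n)
| RankFactor (x y : nat) m n (r : nat) (M : expr m n)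
| FactorQR (x y : nat) m n (M : expr m n)
| FactorSVD (x y z : nat) m n (M : expr m n)
| GEVD (x y z : nat) n (M N : expr n n).

Inductive program (I J K : nat) : Type :=
| Return n (A : expr I n) (B : expr J n) (C : expr K n)
| Do (c : instr) (p : program I J K)
| OrElse (p1 p2 : program I J K).

Record procedure (I J K : nat) := Procedure {
  nrandom : nat;
  body : program I J K
}.

Section Semantics.
Variable F : realType.

Definition store := forall (x m n : nat), 'M[F]_(m, n).

(* conform_mx B A is A when A has the format of B, and B otherwise. *)
Definition upd (s : store) (x m n : nat) (M : 'M[F]_(m, n)) : store :=
  fun x' m' n' => if x' == x then conform_mx (s x' m' n') M else s x' m' n'.

Fixpoint eval (s : store) m n (e : expr m n) : 'M[F]_(m, n) :=
  match e in expr m n return 'M[F]_(m, n) with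
  | Reg x m n => s x m n
  | Const _ _ M => map_mx ratr M
  | Add _ _ e1 e2 => eval s e1 + eval s e2
  | Opp _ _ e => - eval s e
  | Scale _ _ a e => eval s a 0 0 *: eval s e
  | Mul _ _ _ e1 e2 => eval s e1 *m eval s e2
  | RowMx _ _ _ e1 e2 => row_mx (eval s e1) (eval s e2)
  | ColMx _ _ _ e1 e2 => col_mx (eval s e1) (eval s e2)
  | Gather _ _ _ _ f e => \matrix_(i, j) eval s e (f i j).1 (f i j).2
  | Kronecker _ _ _ _ e1 e2 => tensmx (eval s e1) (eval s e2)
  | KhatriRao _ _ _ e1 e2 => khatri_rao (eval s e1) (eval s e2)
  | Compound k _ _ e => compound k (eval s e)
  end.

(* The columns of X form a basis of the orthogonal complement of the column
   space of M. *)
Definition is_orth_complement m n d (M : 'M[F]_(m, n)) (X : 'M[F]_(m, d)) :=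
  [/\ M^T *m X = 0, \rank X = d & (\rank M + d)%N = m].

Definition is_qr m n (M : 'M[F]_(m, n)) (Q : 'M[F]_m) (U : 'M[F]_(m, n)) :=
  [/\ Q^T *m Q = 1%:M,
      forall (i : 'I_m) (j : 'I_n), (j < i)%N -> U i j = 0
    & M = Q *m U].

Definition is_svd m n (M : 'M[F]_(m, n))
    (U : 'M[F]_m) (S : 'M[F]_(m, n)) (V : 'M[F]_n) :=
  [/\ U^T *m U = 1%:M /\ V^T *m V = 1%:M,
      forall (i : 'I_m) (j : 'I_n), i != j :> nat -> S i j = 0,
      forall i j, 0 <= S i j,
      forall (i i' : 'I_m) (j j' : 'I_n), i = j :> nat -> i' = j' :> nat ->
        (i <= i')%N -> S i' j' <= S i j
    & M = U *m S *m V^T].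

(* M, N is a regular pencil and the columns of X are a basis of generalized
   eigenvectors, with projective eigenvalues (a_i : b_i). *)
Definition is_gevd n (M N X : 'M[F]_n) (a b : 'rV[F]_n) :=
  [/\ exists u v : F, u *: M + v *: N \in unitmx,
      X \in unitmx,
      forall i, (a 0 i != 0) || (b 0 i != 0)
    & M *m X *m diag_mx b = N *m X *m diag_mx a].

(* An instruction whose result is not uniquely determined may return any
   admissible result; it fails when there is none. *)
Definition step (c : instr) (s s' : store) : Prop :=
  match c with
  | Assign x _ _ e => s' = upd s x (eval s e)
  | CheckZero _ _ e => eval s e = 0 /\ s' = s
  | Solve x _ _ _ M B =>
      exists2 X, eval s M *m X = eval s B & s' = upd s x X
  | OrthComplement x m _ d M =>
      exists2 X : 'M[F]_(m, d),
        is_orth_complement (eval s M) X & s' = upd s x X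
  | RankFactor x y m n r M =>
      exists (L : 'M[F]_(m, r)) (U : 'M[F]_(r, n)),
        [/\ \rank (eval s M) = r, eval s M = L *m U
          & s' = upd (upd s x L) y U]
  | FactorQR x y _ _ M =>
      exists Q U, is_qr (eval s M) Q U /\ s' = upd (upd s x Q) y U
  | FactorSVD x y z _ _ M =>
      exists U S V, is_svd (eval s M) U S V /\
        s' = upd (upd (upd s x U) y S) z V
  | GEVD x y z _ M N =>
      exists X a b, is_gevd (eval s M) (eval s N) X a b /\
        s' = upd (upd (upd s x X) y a) z b
  end.

Variables I J K : nat.

Record factors := Factors {
  nterms : nat;
  factorA : 'M[F]_(I, nterms);
  factorB : 'M[F]_(J, nterms);
  factorC : 'M[F]_(K, nterms)
}.

(* outcome p s o: o is a possible outcome of p started in s, None standing for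
   failure.  OrElse p1 p2 runs p2 from the initial store when p1 fails. *)
Fixpoint outcome (p : program I J K) (s : store) (o : option factors) : Prop :=
  match p with
  | Return _ A B C => o = Some (Factors (eval s A) (eval s B) (eval s C))
  | Do c p' => (exists2 s', step c s s' & outcome p' s' o) \/
               ((forall s', ~ step c s s') /\ o = None)
  | OrElse p1 p2 => (o <> None /\ outcome p1 s o) \/
                    (outcome p1 s None /\ outcome p2 s o)
  end.

(* Register 0 holds the tensor, register 1 the random numbers. *)
Definition init (T : tensor F I J K) n (w : 'rV[F]_n) : store :=
  upd (upd (fun _ _ _ => 0) 0 (unfolding T)) 1 w.

(* For generic w, i.e. outside the zero set of a nonzero polynomial, the
   procedure has an outcome and all its outcomes are CPDs of T. *)
Definition finds_cpd (P : procedure I J K) (T : tensor F I J K) : Prop :=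
  exists2 g : {mpoly F[nrandom P]}, g != 0 &
    forall w : 'rV[F]_(nrandom P), g.@[w 0] != 0 ->
      (exists o, outcome (body P) (init T w) o) /\
      forall o, outcome (body P) (init T w) o ->
        exists2 f : factors, o = Some f
          & is_cpd T (factorA f) (factorB f) (factorC f).

End Semantics.

(* Main.v *)
(* Replacing the unfolding of the tensor by the left factor of a rank
   factorization reduces to a k x R matrix C any k columns of which are
   independent, k = rank C >= 2 and m = R - k + 2.  By Cauchy-Binet the m-th
   compound of the contraction of the tensor with x is, once vectorized, the
   image of p(x) under the injective C_m(A) (.) C_m(B), where p(x) lists the
   products of the values <c_r, x> over the m-subsets of columns.  These
   products are linearly independent, which bounds the rank from below, and
   they all vanish exactly on the lines orthogonal to k - 1 columns (the
   flats).  So a second decomposition with R terms has the same flats, and by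
   Lagrange interpolation of forms of degree m - 1 at the flats its third
   factor is C up to order and scaling; the other factors follow from the
   ranges of the contractions with the flats.

   Algorithm: the functionals on forms of degree m that kill all the products
   are the combinations of evaluations at the flats.  They are a null space
   computed from sampled compounds; multiplication by two linear forms gives a
   matrix pencil whose eigenvectors separate the flats, and orthogonal
   complements then give the columns of C and A.  No random numbers are used:
   the procedure tries all the weights and labellings from a finite list, and
   its last step, solving a linear system for B, fails unless the
   decomposition is exact. *)

Require Import Defs.
From mathcomp Require Import all_boot all_order all_fingroup all_algebra.
From mathcomp Require Import reals mxtens mpoly.
From mathcomp Require Import zify ring lra boolp.
Set Implicit Arguments.
Unset Strict Implicit.
Unset Printing Implicit Defensive.
Import Order.TTheory GRing.Theory Num.Theory.
Local Open Scope ring_scope.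

(** * Columns in general position *)

Section GeneralPosition.
Variable F : realFieldType.

(** In characteristic zero the naturals below [size p] are distinct, and they outnumber the roots of
    [p]. *)
Lemma poly_nonroot (p : {poly F}) :
  p != 0 -> exists2 n, (n < size p)%N & p.[n%:R] != 0.
Proof.
move=> p0.
have: ~~ all (fun i => root p i%:R) (iota 0 (size p)).
  apply/negP => rp.
  have := @max_poly_roots _ p [seq i%:R | i <- iota 0 (size p)] p0.
  rewrite all_map rp map_inj_uniq ?iota_uniq => [|i j /eqP]; last first.
    by rewrite eqr_nat => /eqP.
  by rewrite size_map size_iota ltnn => /(_ isT isT).
by case/allPn => n; rewrite mem_iota /= => np; exists n.
Qed.

Definition dot k (u x : 'cV[F]_k) : F := (u^T *m x) 0 0.

Definition ev k R (C : 'M[F]_(k, R)) (x : 'cV_k) (r : 'I_R) : F :=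
  (C^T *m x) r 0.

Definition zeros k R (C : 'M[F]_(k, R)) (x : 'cV_k) : {set 'I_R} :=
  [set r | ev C x r == 0].

Definition pev k R (C : 'M[F]_(k, R)) (T : {set 'I_R}) (x : 'cV_k) : F :=
  \prod_(r in T) ev C x r.

(* For [k <= R]: every [k] columns are linearly independent. *)
Definition general_position k R (C : 'M[F]_(k, R)) : Prop :=
  forall x, x != 0 -> (#|zeros C x| < k)%N.

Lemma dotE k (u x : 'cV[F]_k) : dot u x = \sum_i u i 0 * x i 0.
Proof. by rewrite /dot mxE; apply: eq_bigr => i _; rewrite mxE. Qed.

Lemma dotC k (u x : 'cV[F]_k) : dot u x = dot x u.
Proof. by rewrite !dotE; apply: eq_bigr => i _; rewrite mulrC. Qed.

Lemma dotDr k (u x y : 'cV[F]_k) : dot u (x + y) = dot u x + dot u y.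
Proof. by rewrite /dot mulmxDr mxE. Qed.

Lemma dotZr k (u x : 'cV[F]_k) a : dot u (a *: x) = a * dot u x.
Proof. by rewrite /dot -scalemxAr mxE. Qed.

Lemma dotZl k (u x : 'cV[F]_k) a : dot (a *: u) x = a * dot u x.
Proof. by rewrite dotC dotZr dotC. Qed.

Lemma dot0r k (u : 'cV[F]_k) : dot u 0 = 0.
Proof. by rewrite /dot mulmx0 mxE. Qed.

Lemma dotBr k (u x y : 'cV[F]_k) : dot u (x - y) = dot u x - dot u y.
Proof. by rewrite -[- y]scaleN1r dotDr dotZr mulN1r. Qed.

Lemma dot_sumr k (u : 'cV[F]_k) I r (P : pred I) (x : I -> 'cV_k) :
  dot u (\sum_(i <- r | P i) x i) = \sum_(i <- r | P i) dot u (x i).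
Proof. by rewrite (big_morph (dot u) (dotDr u) (dot0r u)). Qed.

Lemma dot_delta k (u : 'cV[F]_k) i : dot u (delta_mx i 0) = u i 0.
Proof.
rewrite dotE (bigD1 i) //= mxE !eqxx mulr1 big1 ?addr0 // => j ji.
by rewrite mxE (negPf ji) mulr0.
Qed.

Lemma dotxx_eq0 k (x : 'cV[F]_k) : (dot x x == 0) = (x == 0).
Proof.
apply/eqP/eqP => [|->]; last by rewrite dot0r.
rewrite dotE => /eqP; rewrite psumr_eq0 => [/allP x0|i _]; last first.
  by rewrite -expr2 sqr_ge0.
apply/colP => i; rewrite mxE; have := x0 i (mem_index_enum i).
by rewrite /= mulf_eq0 orbb => /eqP.
Qed.

Lemma dot_eq0 k (u : 'cV[F]_k) : (forall x, dot u x = 0) -> u = 0.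
Proof. by move=> u0; apply/eqP; rewrite -dotxx_eq0 u0. Qed.

Lemma orth_prop k (a y : 'cV[F]_k) : a != 0 ->
  (forall x, dot x a = 0 -> dot x y = 0) -> exists c, y = c *: a.
Proof.
move=> a0 H.
have [i ai] : exists i, a i 0 != 0.
  apply/existsP; apply: contraT; rewrite negb_exists => /forallP a00.
  case/negP: a0; apply/eqP/colP => i; rewrite mxE; apply/eqP.
  by have := a00 i; rewrite negbK.
exists (y i 0 / a i 0); apply/colP => j; rewrite mxE.
(* This combination of two coordinate vectors is orthogonal to [a]; pairing it with [y] yields the
   [j]-th coordinate of [y]. *)
pose x : 'cV[F]_k := delta_mx j 0 - (a j 0 / a i 0) *: delta_mx i 0.
have xE z : dot x z = z j 0 - a j 0 / a i 0 * z i 0.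
  by rewrite dotC dotBr dotZr !dot_delta.
have /H : dot x a = 0 by rewrite xE divfK ?subrr.
by rewrite xE => /eqP; rewrite subr_eq0 => /eqP ->; field.
Qed.

Section Forms.
Variables (k R : nat) (C : 'M[F]_(k, R)).
Implicit Types (S T U V : {set 'I_R}) (x y u : 'cV[F]_k) (r : 'I_R).

Lemma ev_dot x r : ev C x r = dot (col r C) x.
Proof. by rewrite /ev /dot !mxE; apply: eq_bigr => i _; rewrite !mxE. Qed.

Lemma evD x y r : ev C (x + y) r = ev C x r + ev C y r.
Proof. by rewrite !ev_dot dotDr. Qed.

Lemma evZ a x r : ev C (a *: x) r = a * ev C x r.
Proof. by rewrite !ev_dot dotZr. Qed.

Lemma pevZ T a x : pev C T (a *: x) = a ^+ #|T| * pev C T x.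
Proof.
by rewrite /pev -prodr_const -big_split; apply: eq_bigr => r _; rewrite evZ.
Qed.

Lemma zerosZ a x : a != 0 -> zeros C (a *: x) = zeros C x.
Proof. by move=> a0; apply/setP => r; rewrite !inE evZ mulf_eq0 (negPf a0). Qed.

Lemma pev_neq0 T x : (pev C T x != 0) = [disjoint T & zeros C x].
Proof.
rewrite disjoint_subset; apply/prodf_neq0/subsetP => H r rT;
  by have := H r rT; rewrite !inE.
Qed.

Lemma pev_setU1 r T x : r \notin T -> pev C (r |: T) x = ev C x r * pev C T x.
Proof. by move=> rT; rewrite /pev big_setU1. Qed.

(** At each column that is not a common zero, the value at [x + t *: y] is a nonzero polynomial in
    [t]; any [t] that is not a root of their product works. *)
Lemma zeros_generic x y :
  exists t : F, zeros C (x + t *: y) = zeros C x :&: zeros C y.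
Proof.
pose p : {poly F} := \prod_(r | r \notin zeros C x :&: zeros C y)
  ((ev C x r)%:P + ev C y r *: 'X).
have [|n _ pn] := @poly_nonroot p.
  apply/prodf_neq0 => r; rewrite !inE; apply: contra => /eqP.
  move=> /polyP E; have := E 0; have := E 1.
  by rewrite !coefE /= mulr0 mulr1 add0r addr0 => -> ->; rewrite eqxx.
exists n%:R; apply/setP => r; rewrite !inE evD evZ.
apply/idP/andP => [E|[/eqP-> /eqP->]]; last by rewrite mulr0 addr0.
apply/andP; apply: contraT => rn; case/negP: pn.
rewrite horner_prod; apply/eqP/eqP; rewrite prodf_seq_eq0.
apply/hasP; exists r; rewrite ?mem_index_enum //= !inE rn /=.
by rewrite hornerD hornerC hornerZ hornerX mulrC in E *.
Qed.

(** A vector orthogonal to the columns in [S], equal to [0] if there is no other. For [C] in general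
    position, [#|S| = k.-1] and [0 < k <= R] it spans the line of such vectors. *)
Definition flat (S : {set 'I_R}) : 'cV[F]_k :=
  (nz_row (kermx (colsub (@enum_val _ (mem S)) C)))^T.

Lemma flat_neq0 S : (#|S| < k)%N -> flat S != 0.
Proof.
move=> Sk; rewrite -trmx0 (inj_eq trmx_inj) nz_row_eq0 -mxrank_eq0.
rewrite mxrank_ker -lt0n subn_gt0 (leq_ltn_trans _ Sk) //.
exact: rank_leq_col.
Qed.

Lemma flat_sub S : S \subset zeros C (flat S).
Proof.
apply/subsetP => r rS; rewrite inE ev_dot dotC /dot trmxK.
set z := nz_row _.
have /sub_kermxP/rowP/(_ (enum_rank_in rS r)) : (z <= _)%MS := nz_row_sub _.
rewrite !mxE => E; rewrite -[X in _ == X]E; apply/eqP; apply: eq_bigr => i _.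
by rewrite !mxE enum_rankK_in.
Qed.

Hypothesis Cgp : general_position C.

(** A zero column would be an additional zero of the flat of [k.-1] other columns, giving [k] zeros
    in all. *)
Lemma gp_col_neq0 r : (k <= R)%N -> (0 < k)%N -> col r C != 0.
Proof.
move=> kR k0; apply/eqP => Cr0.
have [S rS cS] : exists2 S : {set 'I_R}, r \in S & #|S| = k.
  case: k kR k0 => // k' kR _.
  have : (k' <= #|[set~ r]|)%N by rewrite cardsC1 card_ord; lia.
  case/card_geqP => s [us ss sr]; exists (r |: [set x in s]).
    by rewrite setU11.
  rewrite cardsU1 inE cardsE (card_uniqP us) ss.
  by case: (boolP (r \in s)) => // /sr; rewrite !inE eqxx.
have f0 : flat (S :\ r) != 0.
  apply: flat_neq0; have := cardsD1 r S; rewrite rS cS add1n => D.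
    by rewrite [ltnRHS]D.
have := Cgp f0; rewrite ltnNge -[X in (X <= _)%N]cS subset_leq_card //.
rewrite -{1}(setD1K rS) subUset flat_sub andbT sub1set inE ev_dot.
by rewrite Cr0 dotC dot0r.
Qed.

Lemma zeros_flat S : #|S| = k.-1 -> (0 < k)%N -> zeros C (flat S) = S.
Proof.
move=> cS k0; apply/esym/eqP; rewrite eqEcard flat_sub /= cS.
have/Cgp: flat S != 0 by apply: flat_neq0; rewrite cS prednK.
by move=> zk; rewrite -ltnS prednK.
Qed.

(** Subtracting the multiple of [flat S] that agrees with [x] at one further column leaves a vector
    with [k] zeros, which is [0]. *)
Lemma flat_uniq S x : #|S| = k.-1 -> (0 < k <= R)%N -> S \subset zeros C x ->
  exists c, x = c *: flat S.
Proof.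
move=> cS /andP[k0 kR] Sx; have zf := zeros_flat cS k0.
have [r rS] : exists r, r \notin S.
  apply/existsP; apply: contraT; rewrite negb_exists => /forallP H.
  suff /eqP : #|S| = R by lia.
  by rewrite -[RHS]card_ord; apply: eq_card => r; rewrite !inE -[LHS]negbK H.
have er : ev C (flat S) r != 0 by move: rS; rewrite -{1}zf inE.
exists (ev C x r / ev C (flat S) r); apply/eqP; rewrite -subr_eq0.
apply: contraT => /Cgp; rewrite ltnNge => /negP; case.
have /subset_leq_card : r |: S \subset
   zeros C (x - (ev C x r / ev C (flat S) r) *: flat S).
  apply/subsetP => v /setU1P vE; rewrite inE -scaleNr evD evZ.
  case: vE => [->|vS].
    by rewrite mulNr divfK // subrr.
  have := subsetP Sx v vS; have : v \in zeros C (flat S) by rewrite zf.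
  by rewrite !inE => /eqP-> /eqP->; rewrite mulr0 addr0.
by rewrite cardsU1 rS cS add1n prednK.
Qed.

(** A vector orthogonal to all columns in [U] has at least [k] zeros, so these columns span; in [M]
    the other columns are replaced by zero rows. *)
Lemma gp_span (U : {set 'I_R}) (u : 'cV[F]_k) : (k <= #|U|)%N ->
  exists c : 'I_R -> F, forall x, dot u x = \sum_(r in U) c r * ev C x r.
Proof.
move=> kU.
pose M : 'M[F]_(R, k) := \matrix_(r, i) ((r \in U)%:R * C i r).
have Mf : row_free M^T.
  apply: inj_row_free => v vM; apply/eqP; apply: contraT => v0.
  have /Cgp : v^T != 0 by rewrite -trmx0 (inj_eq trmx_inj).
  rewrite ltnNge (leq_trans kU) // subset_leq_card //.
  apply/subsetP => r rU; rewrite inE ev_dot dotE.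
  move/rowP/(_ r): vM; rewrite !mxE => E; rewrite -[X in _ == X]E; apply/eqP.
  apply: eq_bigr => i _.
  by rewrite !mxE rU mul1r mulrC.
have /submxP[c uc] : (u^T <= M)%MS.
  by apply: submx_full; rewrite /row_full -mxrank_tr.
exists (c 0) => x; rewrite /dot uc -mulmxA mxE [RHS]big_mkcond /=.
apply: eq_bigr => r _; rewrite mxE; case: ifP => rU.
  congr (_ * _); rewrite ev_dot dotE; apply: eq_bigr => i _.
  by rewrite !mxE rU mul1r.
by rewrite big1 ?mulr0 // => i _; rewrite mxE rU !mul0r.
Qed.

(* For [C] in general position and [j + k <= R.+1] these are all the forms of
   degree [j]. *)
Definition form j (h : 'cV[F]_k -> F) : Prop :=
  exists c : {set 'I_R} -> F,
    forall x, h x = \sum_(T : {set 'I_R} | #|T| == j) c T * pev C T x.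

Lemma form_ext j h g : h =1 g -> form j h -> form j g.
Proof. by move=> hg [c H]; exists c => x; rewrite -hg. Qed.

Lemma form_pev T : form #|T| (pev C T).
Proof.
exists (fun T' => (T' == T)%:R) => x.
rewrite (bigD1 T) //= eqxx mul1r big1 ?addr0 // => T' /andP[_ /negPf->].
by rewrite mul0r.
Qed.

Lemma formD j h g : form j h -> form j g -> form j (fun x => h x + g x).
Proof.
move=> [c Hc] [d Hd]; exists (fun T => c T + d T) => x.
by rewrite Hc Hd -big_split; apply: eq_bigr => T _; rewrite mulrDl.
Qed.

Lemma formZ j a h : form j h -> form j (fun x => a * h x).
Proof.
move=> [c Hc]; exists (fun T => a * c T) => x.
by rewrite Hc mulr_sumr; apply: eq_bigr => T _; rewrite mulrA.
Qed.

Lemma form0 j : form j (fun=> 0).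
Proof. by exists (fun=> 0) => x; rewrite big1 // => T _; rewrite mul0r. Qed.

Lemma form_sum j I (r : seq I) (P : pred I) (h : I -> 'cV[F]_k -> F) :
  (forall i, P i -> form j (h i)) ->
  form j (fun x => \sum_(i <- r | P i) h i x).
Proof.
move=> H; elim: r => [|i r IH].
  by apply: form_ext (form0 j) => x; rewrite big_nil.
case: (boolP (P i)) => Pi.
  by apply: form_ext (formD (H i Pi) IH) => x; rewrite big_cons Pi.
by apply: form_ext IH => x; rewrite big_cons (negPf Pi).
Qed.

(** For each product over [T], [u] is expanded in the columns outside [T], of which [j + k <= R]
    leaves at least [k]; so no column gets repeated. *)
Lemma form_mul j u h : (j + k <= R)%N -> form j h ->
  form j.+1 (fun x => dot u x * h x).
Proof.
move=> jk [c Hc].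
pose t T x := dot u x * pev C T x.
suff H T : #|T| == j -> form j.+1 (fun x => c T * t T x).
  apply: form_ext (form_sum _ H) => x.
  by rewrite Hc mulr_sumr; apply: eq_bigr => T _; rewrite mulrCA.
move=> /eqP cT; apply: formZ.
have [|d Hd] := @gp_span (~: T) u.
  by have := cardsC T; rewrite cT card_ord; lia.
apply: (@form_ext _ (fun x => \sum_(r in ~: T) d r * pev C (r |: T) x)).
  move=> x; rewrite /t Hd mulr_suml; apply: eq_bigr => r.
  by rewrite inE => rT; rewrite pev_setU1 // mulrA.
apply: form_sum => r; rewrite inE => rT; apply: formZ.
have <- : #|r |: T| = j.+1 by rewrite cardsU1 rT cT.
exact: form_pev.
Qed.

Lemma form_prod (us : seq 'cV[F]_k) : (size us + k <= R.+1)%N ->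
  form (size us) (fun x => \prod_(u <- us) dot u x).
Proof.
elim: us => [|u us IH] /= sk.
  apply: (@form_ext _ (pev C set0)).
    by move=> x; rewrite big_nil /pev big_set0.
  by rewrite -(cards0 'I_R); apply: form_pev.
apply: form_ext (form_mul u _ (IH _)); try by lia.
by move=> x; rewrite big_cons.
Qed.

(** A product is nonzero at a flat exactly when its index set avoids the zeros of the flat. Products
    and flats are thus dual up to scalars. *)
Lemma pev_flat (V V' : {set 'I_R}) : #|V| = #|V'| -> #|~: V'| = k.-1 ->
  (0 < k)%N -> (pev C V (flat (~: V')) != 0) = (V == V').
Proof.
move=> cV cV' k0; rewrite pev_neq0 zeros_flat // disjoints_subset setCK.
by rewrite eqEcard cV leqnn andbT.
Qed.

(* Lagrange interpolation: the flats are unisolvent nodes. *)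
Lemma form_interp j h x : (j + k = R.+1)%N -> (0 < k)%N -> form j h ->
  h x = \sum_(T : {set 'I_R} | #|T| == j)
     h (flat (~: T)) / pev C T (flat (~: T)) * pev C T x.
Proof.
move=> jk k0 [c Hc]; rewrite [LHS]Hc; apply: eq_bigr => T /eqP cT.
have cT' : #|~: T| = k.-1 by have := cardsC T; rewrite cT card_ord; lia.
congr (_ * _); rewrite Hc (bigD1 T) ?cT //= big1 ?addr0.
  by rewrite mulfK // pev_flat.
move=> T' /andP[/eqP cTT' TT']; apply/eqP; rewrite mulf_eq0; apply/orP; right.
by apply: contraNT TT'; rewrite pev_flat ?cT.
Qed.

Lemma form_eq0 j h : (j + k = R.+1)%N -> (0 < k)%N -> form j h ->
  (forall S, #|S| = k.-1 -> h (flat S) = 0) -> forall x, h x = 0.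
Proof.
move=> jk k0 fh h0 x; rewrite (form_interp x jk k0 fh) big1 // => T /eqP cT.
by rewrite h0 ?mul0r //; have := cardsC T; rewrite cT card_ord; lia.
Qed.

End Forms.

Lemma pev_form k R N (C : 'M[F]_(k, R)) (D : 'M[F]_(k, N)) (V : {set 'I_N}) :
  general_position C -> (#|V| + k <= R.+1)%N -> form C #|V| (pev D V).
Proof.
move=> Cgp Vk; rewrite cardE; apply: (@form_ext _ _ _ _
   (fun x => \prod_(u <- [seq col r D | r <- enum V]) dot u x)).
  move=> x; rewrite big_map /pev big_enum; apply: eq_bigr => r _.
  by rewrite ev_dot.
by rewrite -(size_map (fun r => col r D)); apply: form_prod => //;
  rewrite size_map -cardE.
Qed.

Lemma form_exp k R (C : 'M[F]_(k, R)) u j :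
  general_position C -> (j + k <= R.+1)%N -> form C j (fun x => dot u x ^+ j).
Proof.
move=> Cgp Vk; rewrite -{1}(size_nseq j u); apply: (@form_ext _ _ _ _
   (fun x => \prod_(u <- nseq j u) dot u x)).
  by move=> x; rewrite big_nseq iter_mulr_1.
by apply: form_prod => //; rewrite size_nseq.
Qed.

End GeneralPosition.

Lemma card_setC_ord R (A : {set 'I_R}) : #|~: A| = (R - #|A|)%N.
Proof. by rewrite cardsCs setCK card_ord. Qed.

Lemma ex_superset R (A : {set 'I_R}) n : (#|A| <= n <= R)%N ->
  exists2 V : {set 'I_R}, A \subset V & #|V| = n.
Proof.
move=> /andP[An nT]; have : (n - #|A| <= #|~: A|)%N.
  by rewrite card_setC_ord leq_sub2r.
case/card_geqP => s [us ss sA]; exists (A :|: [set x in s]); first exact: subsetUl.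
rewrite cardsU cardsE (card_uniqP us) ss.
suff -> : A :&: [set x in s] = set0 by rewrite cards0 subn0 subnKC.
apply/setP => x; rewrite !inE; apply/negP => /andP[xA /sA].
by rewrite inE xA.
Qed.

(** * Generic points, and matching the columns of two matrices with the same flats *)

Section Generic.
Variable F : realFieldType.

(* A finite union of proper subspaces is proper. *)
Lemma zeros_avoid k R (C : 'M[F]_(k, R)) (W : 'cV[F]_k -> Prop)
    (V : {set 'I_R}) :
  W 0 -> (forall t x y, W x -> W y -> W (x + t *: y)) ->
  (forall r, r \in V -> exists2 x, W x & ev C x r != 0) ->
  exists2 x, W x & [disjoint V & zeros C x].
Proof.
move=> W0 Wl WV.
suff [x Wx Hx] : exists2 x, W x & forall r, r \in enum V -> ev C x r != 0.
  exists x => //; rewrite disjoint_subset; apply/subsetP => r rV.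
  by rewrite !inE Hx // mem_enum.
have : forall r, r \in enum V -> exists2 x, W x & ev C x r != 0.
  by move=> r; rewrite mem_enum; apply: WV.
elim: (enum V) => [|r s IH] H; first by exists 0.
have [|x Wx Hx] := IH; first by move=> v vs; apply: H; rewrite inE vs orbT.
have [y Wy yr] := H r (mem_head _ _).
have [t zt] := zeros_generic C x y.
exists (x + t *: y); first exact: Wl.
move=> v vs; apply/negP => zv.
have : v \in zeros C (x + t *: y) by rewrite inE.
rewrite zt !inE => /andP[zx zy]; move: vs; rewrite inE => /orP[/eqP vr|vs].
  by case/negP: yr; rewrite -vr.
by have := Hx v vs; rewrite zx.
Qed.

(** The form [pev C' V] is interpolated at the flats of [C]. If it were nonzero at two flats, both
    would have the [C']-zeros [~: V], so all their combinations would have [k.-1] zeros for [C'],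
    hence for [C]; but a generic combination has only the common [C]-zeros. So at most one node
    contributes. *)
Lemma pev_proportional k R (C C' : 'M[F]_(k, R)) (V : {set 'I_R}) :
  general_position C -> (2 <= k <= R)%N -> (#|V| + k = R.+1)%N ->
  (forall x, (k.-1 <= #|zeros C x|)%N = (k.-1 <= #|zeros C' x|)%N) ->
  exists c (U : {set 'I_R}), #|U| = #|V| /\
    forall x, pev C' V x = c * pev C U x.
Proof.
move=> Cgp /andP[k2 kR] Vk zz; have k0 : (0 < k)%N by lia.
have fV : form C #|V| (pev C' V) by apply: pev_form => //; rewrite Vk.
pose g (T : {set 'I_R}) := flat C (~: T).
have cC (T : {set 'I_R}) : #|T| = #|V| -> #|~: T| = k.-1.
  by move=> cT; rewrite card_setC_ord cT; lia.
have gT (T : {set 'I_R}) : #|T| = #|V| -> zeros C (g T) = ~: T.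
  by move=> cT; rewrite zeros_flat // cC.
have gV (T : {set 'I_R}) : #|T| = #|V| -> pev C' V (g T) != 0 ->
    zeros C' (g T) = ~: V.
  move=> cT; rewrite pev_neq0 disjoint_sym disjoints_subset => Vz; apply/eqP.
  by rewrite eqEcard Vz /= cC // -zz gT // cC.
have uniqT (T1 T2 : {set 'I_R}) : #|T1| = #|V| -> #|T2| = #|V| ->
    pev C' V (g T1) != 0 -> pev C' V (g T2) != 0 -> T1 = T2.
  move=> c1 c2 /(gV _ c1) z1 /(gV _ c2) z2.
  have [t zt] := zeros_generic C (g T1) (g T2).
  have : (k.-1 <= #|zeros C (g T1 + t *: g T2)|)%N.
    rewrite zz -(cC V erefl) subset_leq_card //; apply/subsetP => r rV.
    rewrite inE evD evZ; move: (rV); rewrite -{1}z1 inE => /eqP->.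
    by move: rV; rewrite -z2 inE => /eqP->; rewrite mulr0 addr0.
  rewrite zt !gT // -setCU => H; apply/eqP; rewrite eqEcard c1 c2 leqnn andbT.
  rewrite -setCS; apply/subsetP => r; have /eqP <- : ~: (T1 :|: T2) == ~: T2.
    by rewrite eqEcard setCS subsetUr /= cC.
  by rewrite !inE negb_or => /andP[].
have [/existsP[T /andP[/eqP cT hT]]|no] :=
    boolP [exists T : {set 'I_R}, (#|T| == #|V|) && (pev C' V (g T) != 0)].
  exists (pev C' V (g T) / pev C T (g T)), T; split=> // x.
  rewrite (form_interp Cgp x Vk k0 fV) (bigD1 T) /= ?cT // big1 ?addr0 //.
  move=> T' /andP[/eqP cT' TT'].
  have [->|hT'] := eqVneq (pev C' V (flat C (~: T'))) 0; first by rewrite !mul0r.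
  by rewrite (uniqT T' T) ?eqxx in TT'.
exists 0, V; split=> // x; rewrite (form_interp Cgp x Vk k0 fV) big1 ?mul0r //.
move=> T cT; move: no; rewrite negb_exists => /forallP/(_ T).
by rewrite cT negbK => /eqP ->; rewrite !mul0r.
Qed.

(** By [pev_proportional] the hyperplane orthogonal to a column of [C'] is covered by finitely many
    hyperplanes orthogonal to columns of [C], hence it is one of them. *)
Lemma zeros_match k R (C C' : 'M[F]_(k, R)) :
  general_position C -> (2 <= k <= R)%N ->
  (forall x, (k.-1 <= #|zeros C x|)%N = (k.-1 <= #|zeros C' x|)%N) ->
  (forall r, col r C' != 0) ->
  exists s : 'S_R, forall r, exists c, c != 0 /\ col r C' = c *: col (s r) C.
Proof.
move=> Cgp k2R zz C'0; have /andP[k2 kR] := k2R.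
have k0 : (0 < k)%N by lia.
have ex_rho r' : exists r, exists c, c != 0 /\ col r' C' = c *: col r C.
  have [|V rV cV] := @ex_superset R [set r'] (R.+1 - k).
    by rewrite cards1; lia.
  have [|c [U [cU hU]]] := @pev_proportional _ _ C C' V Cgp k2R _ zz.
    by rewrite cV subnK // ltnW.
  have [x _ Vx] : exists2 x, True & [disjoint V & zeros C' x].
    apply: zeros_avoid => // r _.
    by exists (col r C') => //; rewrite ev_dot dotxx_eq0 C'0.
  have c0 : c != 0.
    by apply: contraTneq Vx => c0; rewrite -pev_neq0 hU c0 mul0r eqxx.
  have [r rU Hr] : exists2 r, r \in U &
      forall x, ev C' x r' = 0 -> ev C x r = 0.
    apply: contrapT => no.
    have [|t y z|r rU|y y0 Uy] := @zeros_avoid _ _ C (fun x => ev C' x r' = 0) U.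
    - by rewrite ev_dot dot0r.
    - by rewrite evD evZ => -> ->; rewrite mulr0 addr0.
    - apply: contrapT => nx; apply: no; exists r => // y y0.
      by apply/eqP; apply: contraT => yr; case: nx; exists y.
    have : pev C' V y = 0 
      by rewrite /pev (bigD1 r') /= ?y0 ?mul0r // -sub1set.
    rewrite hU => /eqP; rewrite mulf_eq0 (negPf c0) /=.
    by apply/negP; rewrite pev_neq0.
  have [|d rd] := @orth_prop _ _ (col r' C') (col r C) (C'0 r').
    by move=> y; rewrite dotC -ev_dot => /Hr; rewrite ev_dot dotC.
  have d0 : d != 0.
    apply: contraTneq isT => d0; rewrite d0 scale0r in rd.
    by have := gp_col_neq0 Cgp r kR k0; rewrite rd eqxx.
  exists r, d^-1; rewrite invr_eq0; split=> //.
  by rewrite rd scalerA mulVf // scale1r.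
have [rho Hrho] : exists rho : 'I_R -> 'I_R,
    forall r', exists c, c != 0 /\ col r' C' = c *: col (rho r') C.
  exact: fin_all_exists ex_rho.
have zrho x : zeros C' x = rho @^-1: zeros C x.
  apply/setP => r; rewrite !inE; have [c [c0 rc]] := Hrho r.
  by rewrite !ev_dot rc dotC dotZr mulf_eq0 (negPf c0) dotC.
(* If two columns had the same image, a set [W] of [R.+2 - k] columns containing both would be
   mapped into a set [V] of size [R.+1 - k]. The flat of [~: V] has [k.-1] zeros for [C], but for
   [C'] its zeros lie in [~: W], of size [k - 2]. *)
have rho_inj : injective rho.
  move=> r1 r2 r12; apply/eqP; apply: contraT => r1n2.
  have [|W rW cW] := @ex_superset R [set r1; r2] (R.+2 - k).
    by rewrite cards2 r1n2; lia.
  have [r1W r2W] : r1 \in W /\ r2 \in W.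
    by split; apply: (subsetP rW); rewrite !inE eqxx ?orbT.
  have [|V WV cV] := @ex_superset R (rho @: W) (R.+1 - k).
    apply/andP; split; last by lia.
    have -> : rho @: W = rho @: (W :\ r1).
      apply/eqP; rewrite eqEsubset [X in _ && X]imsetS ?subD1set // andbT.
      apply/subsetP => _ /imsetP[r rW' ->].
      have [->|rr1] := eqVneq r r1.
        by rewrite r12 imset_f // !inE eq_sym r1n2.
      by rewrite imset_f // !inE rr1.
    apply: leq_trans (leq_imset_card _ _) _.
    have E : (R.+1 - k).+1 = (R.+2 - k)%N by lia.
    by rewrite -ltnS E -cW (cardsD1 r1 W) r1W.
  have cV' : #|~: V| = k.-1 by rewrite card_setC_ord cV; lia.
  have := zz (flat C (~: V)); rewrite zrho zeros_flat // cV' leqnn => /esym H.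
  suff /(leq_trans H) : (#|rho @^-1: (~: V)| <= #|~: W|)%N.
    by rewrite card_setC_ord cW; lia.
  apply: subset_leq_card; apply/subsetP => r; rewrite !inE; apply: contra => rW'.
  by apply: (subsetP WV); apply: imset_f.
by exists (perm rho_inj) => r; have [c Hc] := Hrho r; exists c; rewrite permE.
Qed.

Lemma form_homog k R (C : 'M[F]_(k, R)) j h a x :
  form C j h -> h (a *: x) = a ^+ j * h x.
Proof.
case=> c Hc; rewrite Hc (Hc x) mulr_sumr.
by apply: eq_bigr => T /eqP cT; rewrite pevZ cT mulrCA.
Qed.

(** * Independence of the products of degree [m], and the functionals that kill them *)

Section Flats.
Variables (k R m : nat) (C : 'M[F]_(k, R)).
Hypotheses (Cgp : general_position C) (k2 : (2 <= k)%N) (kR : (k <= R)%N).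

(* A product over an [m]-subset is isolated by a generic point orthogonal to
   the [k - 2] remaining columns. *)
Lemma pev_free (y : {set 'I_R} -> F) : (m + k = R.+2)%N ->
  (forall x, \sum_(T : {set 'I_R} | #|T| == m) y T * pev C T x = 0) ->
  forall T : {set 'I_R}, #|T| = m -> y T = 0.
Proof.
move=> mk y0 T0 cT0; have k0 : (0 < k)%N by lia.
have [|t x z|r rT|x Wx Tx] :=
    @zeros_avoid _ _ C (fun x => forall v, v \notin T0 -> ev C x v = 0) T0.
- by move=> v _; rewrite ev_dot dot0r.
- by move=> Wx Wz v vT; rewrite evD evZ Wx // Wz // mulr0 addr0.
(* As [m >= 2], [T0] has an element [r'] other than [r]; the flat of the complement of [T0 :\ r']
   vanishes outside [T0] but not at [r]. *)
- have /set0Pn[r' /setD1P[r'r r'T]] : T0 :\ r != set0.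
    by rewrite -card_gt0; have := cardsD1 r T0; rewrite rT cT0 add1n; lia.
  have cS : #|~: (T0 :\ r')| = k.-1.
    by rewrite card_setC_ord; have := cardsD1 r' T0; rewrite r'T cT0 add1n; lia.
  exists (flat C (~: (T0 :\ r'))).
    move=> v vT; have : v \in zeros C (flat C (~: (T0 :\ r'))).
      by rewrite zeros_flat // !inE negb_and vT orbT.
    by rewrite inE => /eqP.
  have : r \notin zeros C (flat C (~: (T0 :\ r'))).
    by rewrite zeros_flat // !inE negbK eq_sym r'r.
  by rewrite inE.
have := y0 x; rewrite (bigD1 T0) ?cT0 //= big1 ?addr0; last first.
  move=> T /andP[/eqP cT TT0]; apply/eqP; rewrite mulf_eq0; apply/orP; right.
  have /subsetPn[v vT vT0] : ~~ (T \subset T0).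
    by apply: contra TT0 => sT; rewrite eqEcard sT cT cT0 leqnn.
  by rewrite /pev (bigD1 v) //= Wx ?mul0r.
by move/eqP; rewrite mulf_eq0 -[X in _ || X]negbK pev_neq0 Tx orbF => /eqP.
Qed.

(* Modulo squarefree products of [j.+1] columns, the product of [pev C V],
   [#|V| = j], and a linear form only depends on the value of that form at the
   flat of [~: V]. *)
Lemma functional_flats n (g : 'I_n -> 'cV[F]_k) (z : 'I_n -> F) j :
  (j + k = R.+1)%N ->
  (forall T : {set 'I_R}, #|T| = j.+1 -> \sum_i z i * pev C T (g i) = 0) ->
  exists b : {set 'I_R} -> F, forall w h, form C j h ->
    \sum_i z i * (dot w (g i) * h (g i)) =
    \sum_(V : {set 'I_R} | #|V| == j)
       b V * (dot w (flat C (~: V)) * h (flat C (~: V))).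
Proof.
move=> jk z0; have k0 : (0 < k)%N by lia.
suff /fin_all_exists[b Hb] (V : {set 'I_R}) : exists b, #|V| = j -> forall w,
    \sum_i z i * (dot w (g i) * pev C V (g i)) =
    b * (dot w (flat C (~: V)) * pev C V (flat C (~: V))).
  exists b => w h [c Hc].
  transitivity (\sum_(V : {set 'I_R} | #|V| == j) c V *
                 (\sum_i z i * (dot w (g i) * pev C V (g i)))).
    under eq_bigr do rewrite Hc !mulr_sumr.
    rewrite exchange_big; apply: eq_bigr => V _; rewrite mulr_sumr.
    by apply: eq_bigr => i _; ring.
  apply: eq_bigr => V /eqP cV; rewrite Hb // mulrCA; congr (_ * _).
  rewrite mulrCA; congr (_ * _); rewrite Hc (bigD1 V) ?cV //= big1 ?addr0 //.
  move=> T /andP[/eqP cT TV]; apply/eqP; rewrite mulf_eq0; apply/orP; right.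
  apply: contraNT TV; rewrite pev_flat //; first by rewrite cT cV.
  by rewrite card_setC_ord cV; lia.
have [cV|nV] := eqVneq #|V| j; last by exists 0 => cV; rewrite cV eqxx in nV.
have [V0|[r rV]] := set_0Vmem V; first by rewrite V0 cards0 in cV; lia.
(* These [k] columns span. Times [pev C V], each column outside [V] gives a product killed by [z],
   and it vanishes at the flat as well; on both sides only the coefficient at [r] survives. *)
have cU : #|r |: ~: V| = k by rewrite cardsU1 inE rV card_setC_ord cV; lia.
have zf : zeros C (flat C (~: V)) = ~: V.
  by rewrite zeros_flat // card_setC_ord cV; lia.
have er : ev C (flat C (~: V)) r * pev C V (flat C (~: V)) != 0.
  rewrite mulf_neq0 // ?pev_neq0 ?zf ?disjoints_subset ?setCK //.
  by have := esym (in_set (fun r => ev C (flat C (~: V)) r == 0) r);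
    rewrite -/(zeros C _) zf !inE rV => ->.
exists ((\sum_i z i * (ev C (g i) r * pev C V (g i))) /
        (ev C (flat C (~: V)) r * pev C V (flat C (~: V)))) => _ w.
have [|c Hc] := gp_span Cgp w (_ : (k <= #|r |: ~: V|)%N); first by rewrite cU.
have dE x : dot w x = c r * ev C x r + \sum_(v in ~: V) c v * ev C x v.
  by rewrite Hc big_setU1 //= inE rV.
rewrite (dE (flat _ _)) [X in _ + X]big1 ?addr0 => [|v]; last first.
  by rewrite -{1}zf inE => /eqP ->; rewrite mulr0.
rewrite -[c r * _ * _]mulrA mulrCA divfK //.
under eq_bigr do rewrite dE mulrDl mulrDr.
rewrite big_split /= [X in _ + X](_ : _ = 0) ?addr0.
  by rewrite mulr_sumr; apply: eq_bigr => i _; ring.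
under eq_bigr do rewrite mulr_suml mulr_sumr.
rewrite exchange_big big1 //= => v; rewrite inE => vV.
transitivity (c v * \sum_i z i * pev C (v |: V) (g i)).
  by rewrite mulr_sumr; apply: eq_bigr => i _; rewrite pev_setU1 //; ring.
by rewrite z0 ?mulr0 // cardsU1 vV cV.
Qed.
End Flats.

Definition vandermonde k N : 'M[F]_(k, N) := \matrix_(i, t) (t%:R ^+ i).

(** The zeros of a vector are roots of the nonzero polynomial of size at most [k] that has its
    entries as coefficients. *)
Lemma vandermonde_general_position k N : general_position (vandermonde k N).
Proof.
move=> x x0; pose p := \poly_(i < k) (if insub i is Some i' then x i' 0 else 0).
have evE t : ev (vandermonde k N) x t = p.[t%:R].
  rewrite horner_poly ev_dot dotE; apply: eq_bigr => i _.
  by rewrite !mxE valK mulrC.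
have p0 : p != 0.
  apply: contraNneq x0 => p0; apply/eqP/colP => i; rewrite mxE.
  have := congr1 (fun q : {poly F} => q`_i) p0.
  by rewrite /= coef_poly coef0 ltn_ord valK.
have := @max_poly_roots _ p [seq t%:R | t : 'I_N <- enum (zeros (vandermonde k N) x)] p0.
rewrite size_map -cardE => /(_ _ _)/leq_trans-> //; last exact: size_poly.
  by apply/allP => _ /mapP[t + ->]; rewrite mem_enum inE evE.
rewrite map_inj_uniq ?enum_uniq // => t t' /eqP.
by rewrite eqr_nat => /eqP/val_inj.
Qed.

End Generic.

Lemma map_zeros (F F' : realFieldType) (f : {rmorphism F -> F'}) k R
    (C : 'M[F]_(k, R)) x : zeros (map_mx f C) (map_mx f x) = zeros C x.
Proof.
by apply/setP => r; rewrite !inE /ev map_trmx -map_mxM mxE fmorph_eq0.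
Qed.

(** * Compound matrices and the Cauchy-Binet formula *)

Section Ksubsets.
Variables k p : nat.

Lemma ksubset_sorted (T : 'I_('C(p, k))) :
  sorted ltn [seq val i | i <- ksubset T].
Proof.
have := mem_tnth T (Tuple (size_ksubsets k p)).
by rewrite mem_sort mem_enum inE.
Qed.

Lemma ksubset_uniq (T : 'I_('C(p, k))) : uniq (ksubset T).
Proof.
rewrite -(map_inj_uniq val_inj).
exact: sorted_uniq ltn_trans ltnn _ (ksubset_sorted T).
Qed.

Definition kset (T : 'I_('C(p, k))) : {set 'I_p} := [set x in ksubset T].

Lemma card_kset T : #|kset T| = k.
Proof. by rewrite cardsE (card_uniqP (ksubset_uniq T)) size_tuple. Qed.

Lemma ksubset_inj : injective (@ksubset k p).
Proof.
move=> T T' /eqP; rewrite /ksubset !(tnth_nth (ksubset T)) nth_uniq.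
- by move=> /eqP/val_inj.
- by rewrite (eqP (size_ksubsets k p)).
- by rewrite (eqP (size_ksubsets k p)).
- by rewrite sort_uniq enum_uniq.
Qed.

Lemma kset_inj : injective kset.
Proof.
move=> T T' /setP E; apply/ksubset_inj/val_inj/(inj_map val_inj).
apply: (irr_sorted_eq ltn_trans ltnn); rewrite ?ksubset_sorted // => x.
by apply/mapP/mapP => -[y yT ->]; exists y => //; have := E y; rewrite !inE yT.
Qed.

Lemma kset_surj (S : {set 'I_p}) : #|S| = k -> exists T, kset T = S.
Proof.
move=> cS; have se : sorted ltn [seq val i | i <- enum S].
  apply: (subseq_sorted ltn_trans _ (iota_ltn_sorted 0 p)).
  by rewrite -val_enum_ord map_subseq // [X in subseq _ X]enumT filter_subseq.
have sS : size (enum S) == k by rewrite -cardE cS.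
have : Tuple sS \in Tuple (size_ksubsets k p).
  by rewrite mem_sort mem_enum inE.
case/tnthP => T TE; exists T; apply/setP => x.
by rewrite inE /ksubset -TE mem_enum.
Qed.

Lemma big_kset (V : nmodType) (G : {set 'I_p} -> V) :
  \sum_T G (kset T) = \sum_(S : {set 'I_p} | #|S| == k) G S.
Proof.
rewrite [RHS](reindex_omap kset (fun S => [pick T | kset T == S])) /=.
  apply: eq_bigl => T; rewrite card_kset eqxx /=.
  by case: pickP => [T' /eqP/kset_inj->|/(_ T)]; rewrite ?eqxx.
move=> S /eqP/kset_surj[T <-]; case: pickP => [T' /eqP /= ->//|/(_ T)].
by rewrite eqxx.
Qed.

Lemma prod_kset (A : comPzSemiRingType) (g : 'I_p -> A) T :
  \prod_j g (tnth (ksubset T) j) = \prod_(r in kset T) g r.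
Proof.
rewrite -(big_tuple _ _ (ksubset T) xpredT g) big_uniq ?ksubset_uniq //.
by apply: eq_bigl => r; rewrite inE.
Qed.

End Ksubsets.

Section CauchyBinet.
Variable F : fieldType.

(** Each entry of [A *m B] is a sum over inner indices; distributing the products over these sums
    gives a sum over all choices [f]. *)
Lemma det_mulmx_ffun m R (A : 'M[F]_(m, R)) (B : 'M[F]_(R, m)) :
  \det (A *m B) = \sum_(f : {ffun 'I_m -> 'I_R})
     (\prod_i A i (f i)) * \det (rowsub f B).
Proof.
rewrite /determinant.
transitivity (\sum_(s : 'S_m) \sum_(f : {ffun 'I_m -> 'I_R})
    (-1) ^+ s * (\prod_i A i (f i) * \prod_i B (f i) (s i))).
  apply: eq_bigr => s _; under eq_bigr do rewrite mxE.
  rewrite bigA_distr_bigA /= mulr_sumr; apply: eq_bigr => f _.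
  by rewrite big_split.
rewrite exchange_big; apply: eq_bigr => f _; rewrite mulr_sumr.
apply: eq_bigr => s _; rewrite mulrCA; congr (_ * (_ * _)).
by apply: eq_bigr => i _; rewrite mxE.
Qed.

(** A choice of inner indices that is not injective repeats a row and contributes [0]. An injective
    one is uniquely a permutation followed by an increasing enumeration, and the sum over
    permutations is the minor of [A]. *)
Lemma cauchy_binet m R (A : 'M[F]_(m, R)) (B : 'M[F]_(R, m)) :
  \det (A *m B) = \sum_(T < 'C(R, m))
     \det (colsub (tnth (ksubset T)) A) * \det (rowsub (tnth (ksubset T)) B).
Proof.
rewrite det_mulmx_ffun (bigID (fun f : {ffun 'I_m -> 'I_R} => injectiveb f)) /=.
rewrite [X in _ + X]big1 ?addr0 => [|f /injectivePn[i [j ij fij]]]; last first.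
  rewrite (determinant_alternate ij) ?mulr0 // => l.
  by rewrite !mxE fij.
pose h (u : 'I_('C(R, m)) * 'S_m) := [ffun i => tnth (ksubset u.1) (u.2 i)].
have h_inj : injective h.
  move=> [T s] [T' s'] /ffunP E.
  have TT' : T = T'.
    apply: kset_inj; apply/eqP; rewrite eqEcard !card_kset leqnn andbT.
    apply/subsetP => x; rewrite !inE => /tnthP[j ->].
    have := E (perm_inv s j); rewrite !ffunE /= permKV => ->.
    exact: mem_tnth.
  rewrite -TT' in E *; congr (_, _); apply/permP => i.
  have := E i; rewrite !ffunE /=.
  exact: (tuple_uniqP _ (ksubset_uniq T)).
rewrite (reindex_omap h (fun f => [pick u | h u == f])) /=; last first.
  move=> f /injectiveP fi.
  suff [u uE] : exists u, h u = f.
    by case: pickP => [u' /eqP /= -> //|/(_ u)]; rewrite uE eqxx.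
  have [T TE] : exists T, @kset m R T = f @: 'I_m.
    by apply: kset_surj; rewrite card_imset // card_ord.
  have : perm_eq [tuple f i | i < m] (ksubset T).
    apply: uniq_perm; rewrite ?ksubset_uniq //.
      by rewrite map_inj_uniq ?enum_uniq.
    move=> x; have /setP/(_ x) := TE; rewrite inE => ->.
    by apply/mapP/imsetP => -[i ? ->]; exists i; rewrite ?mem_enum.
  case/tuple_permP => s sE; exists (T, s); apply/ffunP => i; rewrite ffunE /=.
  have : tnth [tuple f i | i < m] i = tnth [tuple tnth (ksubset T) (s i) | i < m] i.
    by congr tnth; apply: val_inj.
  by rewrite !tnth_mktuple.
transitivity (\sum_(T < 'C(R, m)) \sum_(s : 'S_m)
    (\prod_i A i (h (T, s) i)) * \det (rowsub (h (T, s)) B)).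
  rewrite pair_big /=; apply: eq_big => [u|[T s] _] //.
  apply/andP; split.
    apply/injectiveP => i j; rewrite !ffunE.
    by move=> /(tuple_uniqP _ (ksubset_uniq u.1))/perm_inj.
  by case: pickP => [u' /eqP/h_inj->|/(_ u)]; rewrite ?eqxx.
apply: eq_bigr => T _; set t := tnth (ksubset T).
transitivity (\sum_(s : 'S_m) (-1) ^+ s * (\prod_i A i (t (s i))) *
                \det (rowsub t B)).
  apply: eq_bigr => s _; have -> : rowsub (h (T, s)) B = row_perm s (rowsub t B).
    by apply/matrixP => i j; rewrite !mxE ffunE.
  rewrite row_permE det_mulmx det_perm mulrCA mulrA; congr (_ * _ * _).
  by apply: eq_bigr => i _; rewrite ffunE.
rewrite -mulr_suml; congr (_ * _).
by apply: eq_bigr => s _; congr (_ * _); apply: eq_bigr => i _; rewrite mxE.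
Qed.

Lemma compound_diag m I J R (A : 'M[F]_(I, R)) (B : 'M[F]_(J, R))
    (d : 'rV[F]_R) i j :
  compound m (A *m diag_mx d *m B^T) i j =
  \sum_T compound m A i T * compound m B j T * \prod_(r in kset T) d 0 r.
Proof.
rewrite mxE; set f := tnth _; set g := tnth _.
have -> : mxsub f g (A *m diag_mx d *m B^T) =
    (rowsub f A *m diag_mx d) *m (rowsub g B)^T.
  apply/matrixP => a b; rewrite !mxE; apply: eq_bigr => r _; rewrite !mxE.
  by congr (_ * _); apply: eq_bigr => s _; rewrite !mxE.
rewrite cauchy_binet; apply: eq_bigr => T _; rewrite !mxE -/f -/g.
set t := tnth _.
have -> : colsub t (rowsub f A *m diag_mx d) =
    mxsub f t A *m diag_mx (\row_j d 0 (t j)).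
  by apply/matrixP => a b; rewrite [LHS]mxE !mul_mx_diag !mxE.
have -> : rowsub t (rowsub g B)^T = (mxsub g t B)^T.
  by apply/matrixP => a b; rewrite !mxE.
rewrite det_mulmx det_tr det_diag mulrAC; congr (_ * _).
by rewrite -prod_kset; apply: eq_bigr => a _; rewrite mxE.
Qed.

Definition vec p q (M : 'M[F]_(p, q)) : 'cV[F]_(p * q) :=
  \col_i M (mxtens_unindex i).1 (mxtens_unindex i).2.

Lemma vec_compound_diag m I J R (A : 'M[F]_(I, R)) (B : 'M[F]_(J, R)) d :
  vec (compound m (A *m diag_mx d *m B^T)) =
  khatri_rao (compound m A) (compound m B) *m
    \col_T \prod_(r in kset T) d 0 r.
Proof.
apply/colP => i; rewrite [LHS]mxE [RHS]mxE compound_diag.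
apply: eq_bigr => T _.
by rewrite [khatri_rao _ _ _ _]mxE [(\col__ _) _ _]mxE.
Qed.

Lemma vec_diag I J R (A : 'M[F]_(I, R)) (B : 'M[F]_(J, R)) d :
  vec (A *m diag_mx d *m B^T) = khatri_rao A B *m d^T.
Proof.
apply/colP => i; rewrite [LHS]mxE [RHS]mxE mul_mx_diag [LHS]mxE.
by apply: eq_bigr => r _; rewrite !mxE mulrAC.
Qed.

End CauchyBinet.

(** * Consequences of the full column rank of the Khatri-Rao product of compounds *)

Section Independence.
Variable F : realFieldType.

(* Linear independence of every [m] columns, in dual form. *)
Definition col_indep m I R (A : 'M[F]_(I, R)) : Prop :=
  forall U : {set 'I_R}, #|U| = m -> forall u, u \in U ->
  exists x : 'cV_I, dot x (col u A) != 0 /\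
    forall v, v \in U -> v != u -> dot x (col v A) = 0.

Lemma col_indep_le m I R (A : 'M[F]_(I, R)) (V : {set 'I_R}) u :
  (m <= R)%N -> col_indep m A -> (#|V| <= m)%N -> u \in V ->
  exists x : 'cV_I, dot x (col u A) != 0 /\
    forall v, v \in V -> v != u -> dot x (col v A) = 0.
Proof.
move=> mR Ai Vm uV; have [|U VU cU] := @ex_superset R V m; first by rewrite Vm.
have [x [xu xv]] := Ai U cU u (subsetP VU u uV); exists x; split=> // v vV.
exact: xv (subsetP VU v vV).
Qed.

(** A nonzero minor on the columns in [U] gives an invertible submatrix; the rows of its inverse,
    extended by zero, are the dual vectors. *)
Lemma compound_indep m I R (A : 'M[F]_(I, R)) :
  (forall T, exists i, compound m A i T != 0) -> col_indep m A.
Proof.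
move=> H U /kset_surj[T <-] u; rewrite inE => /tnthP[j ->].
have [i] := H T; rewrite mxE; set f := tnth _; set t := tnth _ => dM.
have uM : mxsub f t A \in unitmx by rewrite unitmxE unitfE.
have [y yM] : exists y, y *m mxsub f t A = row j 1%:M.
  by exists (row j (invmx (mxsub f t A))); rewrite -row_mul mulVmx.
have xE v : dot (y *m rowsub f 1%:M)^T (col v A) = \sum_a y 0 a * A (f a) v.
  rewrite /dot trmxK -mulmxA mul_rowsub_mx mul1mx mxE.
  by apply: eq_bigr => a _; rewrite !mxE.
have yE l : \sum_a y 0 a * A (f a) (t l) = (l == j)%:R.
  have /rowP/(_ l) := yM.
  by rewrite !mxE eq_sym => <-; apply: eq_bigr => a _; rewrite !mxE.
exists (y *m rowsub f 1%:M)^T; split; first by rewrite xE yE eqxx oner_eq0.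
move=> v; rewrite inE => /tnthP[l ->] lj; rewrite xE yE.
by rewrite (negPf (_ : l != j)) //; apply: contraNneq lj => ->.
Qed.

Section KhatriRaoCompound.
Variables (m I J R : nat) (A : 'M[F]_(I, R)) (B : 'M[F]_(J, R)).
Hypothesis rKR : \rank (khatri_rao (compound m A) (compound m B)) = 'C(R, m).

Lemma full_rank_mulmx0 p q (M : 'M[F]_(p, q)) r (y : 'M_(q, r)) :
  \rank M = q -> M *m y = 0 -> y = 0.
Proof.
move=> rM My; apply: trmx_inj; rewrite trmx0.
have /row_freeP[M' MM'] : row_free M^T by rewrite /row_free mxrank_tr rM.
by rewrite -[y^T]mulmx1 -MM' mulmxA -trmx_mul My trmx0 mul0mx.
Qed.

Lemma compound_col_neq0 T :
  exists i j, compound m A i T != 0 /\ compound m B j T != 0.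
Proof.
apply: contrapT => H.
have /(full_rank_mulmx0 rKR) :
    khatri_rao (compound m A) (compound m B) *m (delta_mx T 0 : 'cV_('C(R, m))) = 0.
  rewrite -colE; apply/colP => i; rewrite !mxE; apply/eqP; apply: contraT.
  rewrite mulf_eq0 negb_or => /andP[a0 b0]; case: H.
  exists (mxtens_unindex i).1, (mxtens_unindex i).2.
  by split; rewrite mxE.
by move/colP/(_ T)/eqP; rewrite !mxE !eqxx oner_eq0.
Qed.

Lemma kr_compound_indepl : col_indep m A.
Proof.
by apply: compound_indep => T; have [i [j [? _]]] := compound_col_neq0 T; exists i.
Qed.

Lemma kr_compound_indepr : col_indep m B.
Proof.
by apply: compound_indep => T; have [i [j [_ ?]]] := compound_col_neq0 T; exists j.
Qed.

(** As [0 < m], the compound of the zero matrix is zero, so all products of [m] entries of [d]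
    vanish and at most [m] entries are nonzero. Among so few columns, dual vectors for [A] and [B]
    isolate each entry. *)
Lemma kr_diag_eq0 d : (0 < m <= R)%N -> A *m diag_mx d *m B^T = 0 -> d = 0.
Proof.
move=> /andP[m0 mR] ABd.
have d0 T : \prod_(r in @kset m R T) d 0 r = 0.
  have := vec_compound_diag m A B d; rewrite ABd.
  have -> : vec (compound m (0 : 'M[F]_(I, J))) = 0.
    apply/colP => i; rewrite !mxE; case: m m0 => // m' _ in i *.
    rewrite (expand_det_row _ ord0) big1 // => l _; rewrite !mxE mul0r //.
  by move=> /esym/(full_rank_mulmx0 rKR)/colP/(_ T); rewrite !mxE.
pose V := [set r | d 0 r != 0].
have Vm : (#|V| <= m)%N.
  rewrite leqNgt; apply/negP => mV.
  have [s [us ss sV]] := card_geqP (ltnW mV).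
  have [T TE] : exists T, @kset m R T = [set x in s].
    by apply: kset_surj; rewrite cardsE (card_uniqP us) ss.
  have /eqP := d0 T; rewrite TE; apply/negP/prodf_neq0 => r.
  by rewrite inE => /sV; rewrite inE.
apply/rowP => u; rewrite mxE; apply/eqP; apply: contraT => du.
have uV : u \in V by rewrite inE.
have [x [xu xv]] := col_indep_le mR kr_compound_indepl Vm uV.
have [y [yu _]] := col_indep_le mR kr_compound_indepr Vm uV.
have : (x^T *m (A *m diag_mx d *m B^T) *m y) 0 0 = 0.
  by rewrite ABd mulmx0 mul0mx mxE.
have -> : x^T *m (A *m diag_mx d *m B^T) *m y =
    (\row_r (dot x (col r A) * d 0 r)) *m (\col_r dot y (col r B)).
  rewrite !mulmxA -mulmxA; congr (_ *m _); last first.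
    apply/colP => r; rewrite !mxE dotC dotE.
    by apply: eq_bigr => i _; rewrite !mxE.
  apply/rowP => r; rewrite mul_mx_diag !mxE dotE; congr (_ * _).
  by apply: eq_bigr => i _; rewrite !mxE.
rewrite mxE (bigD1 u) //= !mxE big1 ?addr0 => [/eqP|v vu]; last first.
  have [vV|] := boolP (v \in V); first by rewrite !mxE xv ?mul0r.
  by rewrite inE negbK !mxE => /eqP ->; rewrite mulr0 mul0r.
by rewrite !mulf_eq0 (negPf xu) (negPf du) (negPf yu).
Qed.
End KhatriRaoCompound.
End Independence.

(** * Contractions of the tensor and uniqueness *)

Section Slices.
Variable F : realFieldType.

Lemma rank_le_ker I p q (M : 'M[F]_(I, p)) (N : 'M[F]_(I, q)) :
  (forall x : 'rV_I, x *m M = 0 -> x *m N = 0) -> (\rank N <= \rank M)%N.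
Proof.
move=> MN; have : (kermx M <= kermx N)%MS.
  apply/rV_subP => v /sub_kermxP/MN Nv; exact/sub_kermxP.
by move/mxrankS; rewrite !mxrank_ker; have := rank_leq_row N; lia.
Qed.

Lemma rank_kernel_line I (G : 'M[F]_I) (a : 'cV[F]_I) : a != 0 ->
  G^T *m a = 0 -> (forall y, G^T *m y = 0 -> exists c, y = c *: a) ->
  (\rank G + 1)%N = I.
Proof.
move=> a0 Ga Gy; have : \rank (kermx G) = 1%N.
  have <- : \rank a^T = 1%N.
    apply/eqP; rewrite mxrank_tr eqn_leq rank_leq_col lt0n mxrank_eq0 //.
  apply/eqP; rewrite eqn_leq !mxrankS //.
    by apply/sub_kermxP/trmx_inj; rewrite trmx_mul trmxK Ga trmx0.
  apply/rV_subP => v /sub_kermxP vG; have [|c vE] := Gy v^T.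
    by rewrite -trmx_mul vG trmx0.
  by rewrite -[v]trmxK vE linearZ scalemx_sub.
by rewrite mxrank_ker; have := rank_leq_row G; lia.
Qed.

(** The contraction of the tensor with [x] along the third mode. *)
Definition cslice I J k R (A : 'M[F]_(I, R)) (B : 'M[F]_(J, R))
    (C : 'M[F]_(k, R)) (x : 'cV_k) : 'M[F]_(I, J) :=
  A *m diag_mx (C^T *m x)^T *m B^T.

Lemma csliceT I J k R (A : 'M[F]_(I, R)) (B : 'M[F]_(J, R)) (C : 'M[F]_(k, R)) x :
  (cslice A B C x)^T = cslice B A C x.
Proof. by rewrite /cslice !trmx_mul trmxK tr_diag_mx mulmxA. Qed.

Lemma dot_cslice I J k R (A : 'M[F]_(I, R)) (B : 'M[F]_(J, R)) (C : 'M[F]_(k, R))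
    x y z : dot y (cslice A B C x *m z) =
  \sum_r dot y (col r A) * ev C x r * dot z (col r B).
Proof.
rewrite /dot /cslice -!mulmxA mulmxA mxE; apply: eq_bigr => r _.
rewrite mul_diag_mx !mxE -mulrA /ev [X in _ = _ * (X * _)]mxE.
congr (_ * (_ * _)); apply: eq_bigr => i _; first by rewrite !mxE.
by rewrite !mxE mulrC.
Qed.

(** Fewer than [k.-1] zeros means at least [m] nonzero values, that is, some nonzero product. *)
Lemma zeros_pev k R m (C : 'M[F]_(k, R)) x : (m + k = R.+2)%N -> (0 < k)%N ->
  (k.-1 <= #|zeros C x|)%N <-> forall T, pev C (@kset m R T) x = 0.
Proof.
move=> mk k0; split=> [zk T|H].
  apply/eqP; apply: contraT; rewrite pev_neq0 disjoints_subset.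
  have zR : (#|zeros C x| <= R)%N by rewrite -[leqRHS]card_ord max_card.
  by move/subset_leq_card; rewrite card_kset card_setC_ord; lia.
rewrite leqNgt; apply/negP => zk.
have [|s [us ss sz]] := @card_geqP _ (mem (~: zeros C x)) m _.
  by rewrite card_setC_ord; lia.
have [T TE] : exists T, @kset m R T = [set x in s].
  by apply: kset_surj; rewrite cardsE (card_uniqP us) ss.
have /eqP := H T; apply/negP; rewrite pev_neq0 TE disjoints_subset.
by apply/subsetP => r; rewrite inE => /sz.
Qed.

Section Position.
Variables (k R m : nat) (C : 'M[F]_(k, R)).
Hypotheses (Cgp : general_position C) (k2 : (2 <= k)%N) (kR : (k <= R)%N).
Hypothesis mk : (m + k = R.+2)%N.

Let k0 : (0 < k)%N. Proof. lia. Qed.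
Let mR : (m <= R)%N. Proof. lia. Qed.

(** At a flat only the [m.-1] columns outside [S] contribute, and the independence of the columns of
    [B] separates their contributions. *)
Lemma left_kernel I J (A : 'M[F]_(I, R)) (B : 'M[F]_(J, R)) f
    (S : {set 'I_R}) (x : 'cV_I) :
  col_indep m B -> #|S| = k.-1 -> zeros C f = S ->
  (cslice A B C f)^T *m x = 0 <-> forall v, v \notin S -> dot x (col v A) = 0.
Proof.
move=> Bi cS zf; split=> [Ex v vS|H].
  have [||y [yv yw]] := col_indep_le mR Bi (_ : (#|~: S| <= m)%N) (_ : v \in ~: S).
  - by rewrite card_setC_ord cS; lia.
  - by rewrite inE.
  have : dot x (cslice A B C f *m y) = 0.
    by rewrite dotC /dot trmx_mul -mulmxA Ex mulmx0 mxE.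
  rewrite dot_cslice (bigD1 v) //= big1 ?addr0 => [/eqP|w wv]; last first.
    have [|wS] := boolP (w \in S).
      by rewrite -zf inE => /eqP ->; rewrite mulr0 mul0r.
    by rewrite yw ?mulr0 // inE.
  move: vS; rewrite !mulf_eq0 (negPf yv) orbF -zf inE => /negPf->.
  by rewrite orbF => /eqP.
apply: dot_eq0 => y; rewrite /dot trmx_mul trmxK -mulmxA -/(dot _ _).
rewrite dot_cslice big1 // => v _.
have [|vS] := boolP (v \in S); last by rewrite H // !mul0r.
by rewrite -zf inE => /eqP ->; rewrite mulr0 mul0r.
Qed.

Lemma col_indep_neq0 I (A : 'M[F]_(I, R)) r : col_indep m A -> col r A != 0.
Proof.
move=> Ai; have [||x [xr _]] := col_indep_le mR Ai
   (_ : (#|[set r]| <= m)%N) (_ : r \in [set r]).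
- by rewrite cards1; lia.
- by rewrite inE.
by apply: contraNneq xr => ->; rewrite dot0r.
Qed.

(** The contraction has the same left kernel as the submatrix of the [m.-1] columns of [A] outside
    [S], which are independent. *)
Lemma rank_cslice I J (A : 'M[F]_(I, R)) (B : 'M[F]_(J, R)) f
    (S : {set 'I_R}) :
  col_indep m A -> col_indep m B -> #|S| = k.-1 -> zeros C f = S ->
  \rank (cslice A B C f) = m.-1.
Proof.
move=> Ai Bi cS zf; pose A1 := colsub (@enum_val _ (mem (~: S))) A.
have xA1 x : x *m A1 = 0 <-> forall v, v \notin S -> dot x^T (col v A) = 0.
  have xE i : (x *m A1) 0 i = dot x^T (col (enum_val i) A).
    by rewrite /dot trmxK !mxE; apply: eq_bigr => a _; rewrite !mxE.
  split=> [xA v vS|H]; last first.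
    by apply/rowP => i; rewrite xE mxE H //; have := enum_valP i; rewrite inE.
  have vS' : v \in ~: S by rewrite inE.
  by have := xE (enum_rank_in vS' v); rewrite xA mxE enum_rankK_in.
have xE x : x *m cslice A B C f = 0 <->
    forall v, v \notin S -> dot x^T (col v A) = 0.
  split=> [xE|/(left_kernel A x^T Bi cS zf) xE].
    by apply/(left_kernel A x^T Bi cS zf); rewrite -trmx_mul xE trmx0.
  by apply: trmx_inj; rewrite trmx_mul xE trmx0.
have -> : \rank (cslice A B C f) = \rank A1.
  by apply/eqP; rewrite eqn_leq; apply/andP; split;
    apply: rank_le_ker => x; [move/xA1/xE | move/xE/xA1].
have cV : #|~: S| = m.-1 by rewrite card_setC_ord cS; lia.
rewrite -mxrank_tr -cV; apply/eqP/inj_row_free => y yA.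
apply/rowP => i; rewrite mxE.
have [|x [xi xj]] := col_indep_le mR Ai (_ : (#|~: S| <= m)%N) (enum_valP i).
  by rewrite cV; lia.
have : dot x (y *m A1^T)^T = 0 by rewrite yA trmx0 dot0r.
have -> : dot x (y *m A1^T)^T = \sum_j y 0 j * dot x (col (enum_val j) A).
  rewrite /dot trmx_mul trmxK mulmxA mxE; apply: eq_bigr => j _.
  rewrite !mxE mulrC; congr (_ * _).
  by apply: eq_bigr => a _; rewrite !mxE.
rewrite (bigD1 i) //= big1 ?addr0 => [/eqP|j ji]; last first.
  by rewrite xj ?mulr0 ?enum_valP // (inj_eq enum_val_inj).
by rewrite mulf_eq0 (negPf xi) orbF => /eqP.
Qed.

(** The ranges of the contractions at the flats avoiding [r] meet in the line of [col r A]. For a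
    set [U] of [m] columns containing [r], the hypothesis with [u |: ~: U] makes the dual vector of
    each [u != r] orthogonal to [y]. *)
Lemma factor_line I (A : 'M[F]_(I, R)) r y : col_indep m A ->
  (forall S : {set 'I_R}, #|S| = k.-1 -> r \notin S -> forall x,
     (forall v, v \notin S -> dot x (col v A) = 0) -> dot x y = 0) ->
  exists c, y = c *: col r A.
Proof.
move=> Ai H; apply: orth_prop (col_indep_neq0 r Ai) _ => x xr.
have [|U rU cU] := @ex_superset R [set r] m; first by rewrite cards1; lia.
rewrite sub1set in rU.
have Ue u : u \in U -> u != r -> exists e, [/\ dot e (col u A) = 1,
    forall v, v \in U -> v != u -> dot e (col v A) = 0 & dot e y = 0].
  move=> uU ur; have [e [eu ev]] := Ai U cU u uU.
  exists ((dot e (col u A))^-1 *: e); split.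
  - by rewrite dotZl mulVf.
  - by move=> v vU vu; rewrite dotZl (ev v) ?mulr0.
  rewrite dotZl (H (u |: ~: U)) ?mulr0 //.
  - by rewrite cardsU1 inE uU card_setC_ord cU; lia.
  - by rewrite !inE negb_or eq_sym ur negbK.
  by move=> v; rewrite !inE negb_or negbK => /andP[? ?]; apply: ev.
have /fin_all_exists[e He] u : exists e, u \in U -> u != r ->
    [/\ dot e (col u A) = 1,
    forall v, v \in U -> v != u -> dot e (col v A) = 0 & dot e y = 0].
  have [uU|_] := boolP (u \in U); last by exists 0.
  have [->|ur] := eqVneq u r; first by exists 0.
  by have [e] := Ue u uU ur; exists e.
(* Corrected by the dual vectors, [x] becomes orthogonal to all columns in [U]; its pairing with [y]
   does not change. *)
pose x' := x - \sum_(u in U :\ r) dot x (col u A) *: e u.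
have x'E z : dot x' z = dot x z - \sum_(u in U :\ r) dot x (col u A) * dot (e u) z.
  rewrite dotC dotBr dot_sumr (dotC z); congr (_ - _); apply: eq_bigr => u _.
  by rewrite dotZr (dotC z).
have : dot x' y = 0.
  have [u0 u0U] : exists u0, u0 \in U :\ r.
    apply/set0Pn; rewrite -card_gt0; have := cardsD1 r U.
    by rewrite rU cU add1n; lia.
  have /setD1P[u0r u0U'] := u0U.
  apply: (H (u0 |: ~: U)).
  - by rewrite cardsU1 inE u0U' card_setC_ord cU; lia.
  - by rewrite !inE negb_or eq_sym u0r negbK.
  move=> v; rewrite !inE negb_or negbK => /andP[_ vU]; rewrite x'E.
  have [->|vr] := eqVneq v r.
    rewrite xr big1 ?subr0 // => u /setD1P[ur uU].
    by have [_ -> //] := He u uU ur; rewrite ?mulr0 // eq_sym.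
  rewrite (bigD1 v) ?inE ?vr //= big1 ?addr0 => [|u /andP[/setD1P[ur uU] uv]].
    by have [-> _ _] := He v vU vr; rewrite mulr1 subrr.
  by have [_ -> //] := He u uU ur; rewrite ?mulr0 // eq_sym.
rewrite x'E big1 ?subr0 // => u /setD1P[ur uU].
by have [_ _ ->] := He u uU ur; rewrite mulr0.
Qed.

(** For a set [U] of [k] columns containing [r], the flats of [U :\ u] form a basis dual to [U] up
    to scalars. A vector orthogonal to [col r C] involves only those with [u != r], to which the
    hypothesis applies. *)
Lemma third_factor_line r y :
  (forall S : {set 'I_R}, #|S| = k.-1 -> r \in S -> dot y (flat C S) = 0) ->
  exists c, y = c *: col r C.
Proof.
move=> H; apply: orth_prop (gp_col_neq0 Cgp r kR k0) _ => x xr.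
have [|U rU cU] := @ex_superset R [set r] k; first by rewrite cards1 k0.
rewrite sub1set in rU.
have cUu u : u \in U -> #|U :\ u| = k.-1.
  by move=> uU; rewrite -cU (cardsD1 u U) uU.
have zU u : u \in U -> zeros C (flat C (U :\ u)) = U :\ u.
  by move=> uU; rewrite zeros_flat // cUu.
pose x' := \sum_(u in U) (ev C x u / ev C (flat C (U :\ u)) u) *: flat C (U :\ u).
have -> : x = x'.
  apply/eqP; rewrite -subr_eq0; apply: contraT => /Cgp; rewrite ltnNge => /negP[].
  rewrite -[leqLHS]cU subset_leq_card //; apply/subsetP => u uU.
  rewrite inE ev_dot dotBr dot_sumr (bigD1 u) //= big1 ?addr0 => [|v /andP[vU vu]].
    rewrite dotZr -!ev_dot divfK ?subrr //.
    have : u \notin zeros C (flat C (U :\ u)) by rewrite zU // !inE eqxx.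
    by rewrite inE.
  have : u \in zeros C (flat C (U :\ v)) by rewrite zU // !inE uU eq_sym vu.
  by rewrite inE dotZr -ev_dot => /eqP->; rewrite mulr0.
rewrite dotC dot_sumr big1 // => u uU; rewrite dotZr.
have [->|ur] := eqVneq u r; first by rewrite ev_dot dotC xr !mul0r.
by rewrite H ?mulr0 ?cUu // !inE eq_sym ur rU.
Qed.

Lemma factors_unique I J (A A' : 'M[F]_(I, R)) (B B' : 'M[F]_(J, R)) :
  \rank (khatri_rao (compound m A) (compound m B)) = 'C(R, m) ->
  \rank (khatri_rao (compound m A') (compound m B')) = 'C(R, m) ->
  (forall x, cslice A B C x = cslice A' B' C x) ->
  exists a b : 'I_R -> F, forall r, [/\ a r * b r = 1,
    col r A' = a r *: col r A & col r B' = b r *: col r B].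
Proof.
move=> rK rK' E.
have Ai := kr_compound_indepl rK; have Bi := kr_compound_indepr rK.
have Ai' := kr_compound_indepl rK'; have Bi' := kr_compound_indepr rK'.
have zf (S : {set 'I_R}) : #|S| = k.-1 -> zeros C (flat C S) = S.
  by move=> cS; rewrite zeros_flat.
have /fin_all_exists[a Ha] r : exists a, col r A' = a *: col r A.
  apply: factor_line Ai _ => S cS rS x /(left_kernel A x Bi cS (zf _ cS)).
  by rewrite E => /(left_kernel A' x Bi' cS (zf _ cS)); apply.
have /fin_all_exists[b Hb] r : exists b, col r B' = b *: col r B.
  apply: factor_line Bi _ => S cS rS x /(left_kernel B x Ai cS (zf _ cS)).
  rewrite csliceT E -csliceT.
  by move=> /(left_kernel B' x Ai' cS (zf _ cS)); apply.
exists a, b => r; split=> //.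
(* Contracting with [col r C] gives the [r]-th term a nonzero coefficient, so the injectivity in
   [kr_diag_eq0] forces [a r * b r = 1]. *)
have [d dE] : exists d, d = (C^T *m col r C)^T by exists (C^T *m col r C)^T.
have A'E i v : A' i v = a v * A i v.
  by have /colP/(_ i) := Ha v; rewrite !mxE.
have B'E j v : B' j v = b v * B j v.
  by have /colP/(_ j) := Hb v; rewrite !mxE.
have E' : cslice A' B' C (col r C) =
    A *m diag_mx (\row_v (a v * b v * d 0 v)) *m B^T.
  rewrite /cslice -dE !mul_mx_diag; apply/matrixP => i j.
  rewrite [LHS]mxE [RHS]mxE; apply: eq_bigr => v _.
  by rewrite !mxE A'E B'E; ring.
have m0R : (0 < m <= R)%N by lia.
have /(kr_diag_eq0 rK m0R)/rowP/(_ r) :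
    A *m diag_mx (d - \row_v (a v * b v * d 0 v)) *m B^T = 0.
  rewrite linearB /= mulmxBr mulmxBl -E' -E /cslice -dE subrr //.
rewrite dE !mxE => /eqP; rewrite -[X in X - _]mul1r -mulrBl mulf_eq0.
have -> : (\sum_j C^T r j * col r C j 0 == 0) = false.
  have -> : \sum_j C^T r j * col r C j 0 = dot (col r C) (col r C).
    by rewrite dotE; apply: eq_bigr => i _; rewrite !mxE.
  by rewrite dotxx_eq0; apply/negbTE/gp_col_neq0.
by rewrite orbF subr_eq0 => /eqP ->.
Qed.
End Position.
End Slices.

(** * Compression of the third factor, the rank bound and the matching of decompositions *)

Section Compression.
Variable F : realFieldType.

(** The maximum in [krank] is attained, because size [0] satisfies its condition. *)
Lemma krankP p q (M : 'M[F]_(p, q)) (S : {set 'I_q}) : #|S| = krank M ->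
  \rank (colsub (@enum_val _ (mem S)) M) = krank M.
Proof.
pose P (k : 'I_q.+1) := [forall S : {set 'I_q}, (#|S| == k) ==>
  (\rank (colsub (@enum_val _ (mem S)) M) == k)].
have P0 : (0 < #|P|)%N.
  apply/card_gt0P; exists ord0; apply/forall_inP => S' /eqP cS.
  by rewrite -leqn0 (leq_trans (rank_leq_col _)) // cS.
have [k /forall_inP Pk kE] := eq_bigmax_cond (fun k : 'I_q.+1 => k : nat) P0.
have -> : krank M = k by [].
by move=> /eqP/Pk/eqP.
Qed.

Lemma kr_row_free m I J R (A : 'M[F]_(I, R)) (B : 'M[F]_(J, R)) :
  (0 < m <= R)%N ->
  \rank (khatri_rao (compound m A) (compound m B)) = 'C(R, m) ->
  row_free (khatri_rao A B)^T.
Proof.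
move=> mR rK; apply: inj_row_free => d dK; apply: (kr_diag_eq0 rK mR).
have : khatri_rao A B *m d^T = 0 by apply: trmx_inj; rewrite trmx_mul trmxK trmx0.
rewrite -vec_diag => /colP V; apply/matrixP => i j.
by have := V (mxtens_index (i, j)); rewrite !mxE mxtens_indexK.
Qed.

(** The counterpart of [cslice] for a tensor known only through its unfolding. *)
Definition slice I J k (L : 'M[F]_(I * J, k)) (x : 'cV_k) : 'M[F]_(I, J) :=
  \matrix_(i, j) (L *m x) (mxtens_index (i, j)) 0.

Lemma vec_slice I J k (L : 'M[F]_(I * J, k)) x : vec (slice L x) = L *m x.
Proof.
apply/colP => i; by rewrite !mxE -surjective_pairing mxtens_unindexK.
Qed.

Lemma slice_kr I J k R (A : 'M[F]_(I, R)) (B : 'M[F]_(J, R)) (C : 'M[F]_(k, R)) x :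
  slice (khatri_rao A B *m C^T) x = cslice A B C x.
Proof.
have : vec (slice (khatri_rao A B *m C^T) x) = vec (cslice A B C x).
  by rewrite vec_slice vec_diag trmxK mulmxA.
move/colP => V; apply/matrixP => i j.
by have := V (mxtens_index (i, j)); rewrite !mxE mxtens_indexK.
Qed.

Lemma vec_compound_cslice m I J k R (A : 'M[F]_(I, R)) (B : 'M[F]_(J, R))
    (C : 'M[F]_(k, R)) x :
  vec (compound m (cslice A B C x)) =
  khatri_rao (compound m A) (compound m B) *m \col_T pev C (@kset m R T) x.
Proof.
rewrite vec_compound_diag; congr (_ *m _); apply/colP => T; rewrite !mxE.
by apply: eq_bigr => r _; rewrite mxE.
Qed.

(** A left inverse of [khatri_rao A B] and a right inverse of [U] express both [L] and [C] through
    the same [C1]. *)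
Lemma compress I J K k R (A : 'M[F]_(I, R)) (B : 'M[F]_(J, R)) (C : 'M[F]_(K, R))
    (L : 'M_(I * J, k)) (U : 'M_(k, K)) :
  row_free (khatri_rao A B)^T -> row_free U ->
  khatri_rao A B *m C^T = L *m U ->
  exists C1 : 'M_(k, R), L = khatri_rao A B *m C1^T /\ C = U^T *m C1.
Proof.
move=> /row_freeP[X KX] Uf E; exists (C^T *m pinvmx U)^T.
have LE : L = khatri_rao A B *m (C^T *m pinvmx U)^T^T.
  by rewrite trmxK mulmxA E mulmxKp.
split=> //; apply: trmx_inj; rewrite trmx_mul !trmxK.
have KX' : X^T *m khatri_rao A B = 1%:M by rewrite -[khatri_rao _ _]trmxK -trmx_mul KX trmx1.
by rewrite -[LHS]mul1mx -KX' -mulmxA E [in LHS]LE trmxK !mulmxA KX' mul1mx.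
Qed.

(** Any [k] columns of [C] have rank [k] and factor through the same columns of [C1], a square block
    that is therefore invertible. *)
Lemma compress_general_position K k R (C : 'M[F]_(K, R)) (U : 'M_(k, K)) (C1 : 'M_(k, R)) :
  krank C = k -> C = U^T *m C1 -> general_position C1.
Proof.
move=> kC CE x x0; rewrite ltnNge; apply/negP => kz.
have [s [us ss sz]] := card_geqP kz; pose S := [set r in s].
have cS : #|S| = krank C by rewrite cardsE (card_uniqP us) ss.
have := krankP cS; rewrite {1}CE -mulmx_colsub kC => rS.
have C1f : row_free (colsub (@enum_val _ (mem S)) C1).
  rewrite /row_free eqn_leq rank_leq_row /= -[leqLHS]rS.
  exact: mxrankM_maxr.
case/eqP: x0; apply: trmx_inj; rewrite trmx0; apply/eqP.
rewrite -(mulmx_free_eq0 _ C1f); apply/eqP/rowP => i; rewrite [RHS]mxE.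
have : enum_val i \in zeros C1 x by apply: sz; have := enum_valP i; rewrite inE.
rewrite inE ev_dot dotC /dot mxE => /eqP E; rewrite -[RHS]E !mxE.
by apply: eq_bigr => j _; rewrite !mxE.
Qed.

Section RankBound.
Variables (I J k m R : nat) (A : 'M[F]_(I, R)) (B : 'M[F]_(J, R)).
Variables (C : 'M[F]_(k, R)).
Hypotheses (Cgp : general_position C) (k2 : (2 <= k)%N) (kR : (k <= R)%N).
Hypothesis mk : (m + k = R.+2)%N.
Hypothesis rK : \rank (khatri_rao (compound m A) (compound m B)) = 'C(R, m).
Variables (n : nat) (A' : 'M[F]_(I, n)) (B' : 'M[F]_(J, n)) (C' : 'M[F]_(k, n)).
Hypothesis sE : forall x, cslice A B C x = cslice A' B' C' x.

(** A row vector that kills the matrix on the right kills the vectorized compounds of all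
    contractions. Written with [A], [B] and [C] this is a linear relation between the products
    [pev C T], which are independent. *)
Lemma rank_compound_le :
  ('C(R, m) <= \rank (khatri_rao (compound m A') (compound m B')))%N.
Proof.
rewrite -rK; apply: rank_le_ker => w wK'; apply/rowP => T0; rewrite [RHS]mxE.
set w' := w *m _.
(* The coefficients as a function on subsets; the default [0] is reached only at sizes other than
   [m]. *)
pose idx (S : {set 'I_R}) := if [pick T | kset T == S] is Some T then w' 0 T else 0.
have idxE T : idx (kset T) = w' 0 T.
  by rewrite /idx; case: pickP => [T' /eqP/kset_inj->|/(_ T)] //; rewrite eqxx.
rewrite -idxE; apply: (pev_free Cgp k2 kR mk) (card_kset T0) => x.
rewrite -(big_kset m (fun S : {set 'I_R} => idx S * pev C S x)).
transitivity ((w *m vec (compound m (cslice A B C x))) 0 0).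
  rewrite vec_compound_cslice mulmxA -/w' mxE; apply: eq_bigr => T _.
  by rewrite idxE [X in _ = _ * X]mxE.
by rewrite sE vec_compound_cslice mulmxA wK' mul0mx mxE.
Qed.

(** With fewer terms the rank would be at most ['C(n, m)], which is less than ['C(R, m)] because
    [0 < m <= R]. *)
Lemma terms_ge : (R <= n)%N.
Proof.
rewrite leqNgt; apply/negP => nR.
have := leq_trans rank_compound_le (rank_leq_col _).
case: R nR mk kR => // R' nR mk' kR'; rewrite leqNgt; case/negP.
case: m mk' => [|m'] mk'; first by lia.
rewrite binS; apply: leq_ltn_trans (leq_bin2l _ (_ : n <= R')%N) _ => //.
by rewrite -[ltnLHS]addn0 ltn_add2l bin_gt0; lia.
Qed.

End RankBound.

Section Match.
Variables (I J k m R : nat) (A A' : 'M[F]_(I, R)) (B B' : 'M[F]_(J, R)).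
Variables (C C' : 'M[F]_(k, R)).
Hypotheses (Cgp : general_position C) (k2 : (2 <= k)%N) (kR : (k <= R)%N).
Hypothesis mk : (m + k = R.+2)%N.
Hypothesis rK : \rank (khatri_rao (compound m A) (compound m B)) = 'C(R, m).
Hypothesis C'0 : forall r, col r C' != 0.
Hypothesis sE : forall x, cslice A B C x = cslice A' B' C' x.

Lemma compound_full (A2 : 'M[F]_(I, R)) (B2 : 'M[F]_(J, R)) (C2 : 'M[F]_(k, R)) :
  (forall x, cslice A B C x = cslice A2 B2 C2 x) ->
  \rank (khatri_rao (compound m A2) (compound m B2)) = 'C(R, m).
Proof.
move=> sE2; apply/eqP; rewrite eqn_leq rank_leq_col.
exact: rank_compound_le sE2.
Qed.

(** Having at least [k.-1] zeros amounts to the vanishing of the [m]-th compound of the contraction,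
    a property of the tensor alone; so [zeros_match] applies. *)
Lemma cpd_match : exists (s : 'S_R) (a b c : 'I_R -> F), forall r,
  [/\ a r * b r * c r = 1, col r A' = a r *: col (s r) A,
      col r B' = b r *: col (s r) B & col r C' = c r *: col (s r) C].
Proof.
have k0 : (0 < k)%N by lia.
have [||s Hs] := zeros_match Cgp _ _ C'0; first by rewrite k2.
  move=> x; have key (A1 : 'M_(I, R)) (B1 : 'M_(J, R)) (C1 : 'M_(k, R)) :
      (forall x, cslice A B C x = cslice A1 B1 C1 x) ->
      (k.-1 <= #|zeros C1 x|)%N <-> vec (compound m (cslice A B C x)) = 0.
    move=> sE1; rewrite (zeros_pev C1 x mk k0) sE1 vec_compound_cslice.
    split=> [H|/(full_rank_mulmx0 (compound_full sE1))/colP H T].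
      rewrite [X in _ *m X](_ : _ = 0) ?mulmx0 //.
      by apply/colP => T; rewrite !mxE.
    by have := H T; rewrite !mxE.
  by apply/idP/idP => /key H; apply/key; try exact: H.
have /fin_all_exists[c Hc] := Hs.
(* The second decomposition is reordered so that its third factor becomes [C], the scalars moving
   into the first factor. *)
pose A1 := \matrix_(i, r) (A' i (s^-1 r)%g * c (s^-1 r)%g).
pose B1 := \matrix_(i, r) B' i (s^-1 r)%g.
have sE1 x : cslice A B C x = cslice A1 B1 C x.
  rewrite sE /cslice; apply/matrixP => i j; rewrite !mul_mx_diag.
  rewrite [LHS]mxE [RHS]mxE [RHS](reindex_inj (@perm_inj _ s)) /=.
  apply: eq_bigr => r _; have [_ Cr] := Hc r.
  have Er : (C'^T *m x) r 0 = c r * (C^T *m x) (s r) 0.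
    by rewrite -!/(ev _ _ _) !ev_dot Cr dotZl.
  rewrite [in LHS]mxE [in RHS]mxE ![_^T 0 _]mxE Er !mxE permK; ring.
have [a [b Hab]] := factors_unique Cgp k2 kR mk rK (compound_full sE1) sE1.
exists s, (fun r => a (s r) / c r), (fun r => b (s r)), c => r.
have [c0 Cr] := Hc r; have [ab Ea Eb] := Hab (s r).
split=> //; first by rewrite mulrAC divfK // -ab.
  apply/colP => i; have /colP/(_ i) := Ea; rewrite !mxE permK => E.
  by rewrite mulrAC -E mulfK.
by apply/colP => i; have /colP/(_ i) := Eb; rewrite !mxE permK.
Qed.
End Match.
End Compression.

(** * Rank and uniqueness for the uncompressed tensor *)

Section TensorRank.
Variables (F : realType) (I J K : nat).

Lemma polyadicE n (A : 'M[F]_(I, n)) (B : 'M[F]_(J, n)) (C : 'M[F]_(K, n)) i j k :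
  polyadic A B C (i, j, k) = \sum_r A i r * B j r * C k r.
Proof.
by rewrite /polyadic sum_ffunE; apply: eq_bigr => r _; rewrite ffunE !mxE.
Qed.

Lemma unfolding_polyadic n (A : 'M[F]_(I, n)) (B : 'M[F]_(J, n)) (C : 'M[F]_(K, n)) :
  unfolding (polyadic A B C) = khatri_rao A B *m C^T.
Proof.
apply/matrixP => i k; rewrite !mxE polyadicE.
by apply: eq_bigr => r _; rewrite !mxE.
Qed.

Lemma outer_neq0 (a : 'cV[F]_I) (b : 'cV[F]_J) (c : 'cV[F]_K) :
  rank1 (outer a b c) -> [/\ a != 0, b != 0 & c != 0].
Proof.
case=> a' [b' [c' [a0 b0 c0 E]]].
have [i ai] : exists i, a' i 0 != 0 by apply/cV0Pn.
have [j bj] : exists j, b' j 0 != 0 by apply/cV0Pn.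
have [k ck] : exists k, c' k 0 != 0 by apply/cV0Pn.
have : outer a b c (i, j, k) != 0 by rewrite E ffunE /= !mulf_neq0.
rewrite ffunE /= !mulf_eq0 !negb_or => /andP[/andP[ai' bj'] ck'].
by split; apply/cV0Pn; [exists i | exists j | exists k].
Qed.

Lemma sum_of_rank1_polyadic (T : tensor F I J K) n : sum_of_rank1 T n ->
  exists (A : 'M[F]_(I, n)) (B : 'M[F]_(J, n)) (C : 'M[F]_(K, n)),
    T = polyadic A B C.
Proof.
case=> Y Y1 ->.
have /fin_all_exists[abc H] r : exists u : 'cV[F]_I * 'cV[F]_J * 'cV[F]_K,
    Y r = outer u.1.1 u.1.2 u.2.
  by have [a [b [c [_ _ _ ->]]]] := Y1 r; exists (a, b, c).
exists (\matrix_(i, r) (abc r).1.1 i 0), (\matrix_(j, r) (abc r).1.2 j 0),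
  (\matrix_(k, r) (abc r).2 k 0).
apply: eq_bigr => r _; rewrite H; apply/ffunP => x; rewrite !ffunE.
by rewrite !mxE.
Qed.

Lemma polyadic_sum_of_rank1 n (A : 'M[F]_(I, n)) (B : 'M[F]_(J, n))
    (C : 'M[F]_(K, n)) :
  sum_of_rank1 (polyadic A B C)
    #|[set r | [&& col r A != 0, col r B != 0 & col r C != 0]]|.
Proof.
set S := [set r | _].
exists (fun i : 'I_#|S| => outer (col (enum_val i) A) (col (enum_val i) B)
                                 (col (enum_val i) C)).
  move=> i; have := enum_valP i; rewrite inE => /and3P[a0 b0 c0].
  by exists (col (enum_val i) A), (col (enum_val i) B), (col (enum_val i) C).
rewrite -(big_enum_val (fun r => outer (col r A) (col r B) (col r C))).
rewrite /polyadic [LHS](bigID (mem S)) /= [X in _ + X]big1 ?addr0 // => r.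
rewrite inE !negb_and !negbK => H; apply/ffunP => x; rewrite !ffunE.
by case/or3P: H => /eqP->; rewrite [(0 : 'M_(_, _)) _ _]mxE ?mulr0 ?mul0r.
Qed.

(** A vanishing term could be dropped, leaving fewer than [n] terms of rank 1. *)
Lemma is_cpd_polyadic (T : tensor F I J K) n (A : 'M[F]_(I, n))
    (B : 'M[F]_(J, n)) (C : 'M[F]_(K, n)) :
  has_rank T n -> T = polyadic A B C -> is_cpd T A B C.
Proof.
move=> rT TE; split=> // r.
set S := [set r | [&& col r A != 0, col r B != 0 & col r C != 0]].
have : S = setT.
  apply/eqP; rewrite eqEcard subsetT cardsT card_ord.
  by apply: rT.2; rewrite TE; apply: polyadic_sum_of_rank1.
move/setP/(_ r); rewrite !inE => /and3P[? ? ?].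
by exists (col r A), (col r B), (col r C).
Qed.

Section Uniqueness.
Variables (R m : nat) (A : 'M[F]_(I, R)) (B : 'M[F]_(J, R)) (C : 'M[F]_(K, R)).
Let k := \rank C.
Hypotheses (k2 : (2 <= k)%N) (kR : (k <= R)%N) (mk : (m + k = R.+2)%N).
Hypothesis kC : krank C = k.
Hypothesis rK : \rank (khatri_rao (compound m A) (compound m B)) = 'C(R, m).
Let T := polyadic A B C.

Let m0R : (0 < m <= R)%N. Proof. lia. Qed.

Lemma rank_unfolding : \rank (unfolding T) = k.
Proof.
rewrite unfolding_polyadic -mxrank_tr trmx_mul trmxK.
by rewrite mxrankMfree // (kr_row_free m0R rK).
Qed.

Lemma compressed (L : 'M_(I * J, k)) (U : 'M_(k, K)) : unfolding T = L *m U ->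
  row_free U /\
  exists C1 : 'M_(k, R), [/\ general_position C1, L = khatri_rao A B *m C1^T & C = U^T *m C1].
Proof.
move=> E; have Uf : row_free U.
  rewrite /row_free eqn_leq rank_leq_row -{1}rank_unfolding E.
  exact: mxrankM_maxr.
split=> //; rewrite unfolding_polyadic in E.
have [C1 [LE CE]] := compress (kr_row_free m0R rK) Uf E.
exists C1; split=> //; exact: compress_general_position kC CE.
Qed.

Lemma compression_exists : exists (L : 'M_(I * J, k)) (U : 'M_(k, K)),
  unfolding T = L *m U.
Proof.
move: rank_unfolding => <-; exists (col_base (unfolding T)).
by exists (row_base (unfolding T)); rewrite mulmx_base.
Qed.

Lemma kr_C_col_neq0 r : col r C != 0.
Proof.
have [L [U E]] := compression_exists; have [Uf [C1 [Cgp _ CE]]] := compressed E.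
have := gp_col_neq0 Cgp r kR (ltnW k2); apply: contra_neq => Cr.
apply: trmx_inj; rewrite trmx0; apply/eqP.
rewrite -(mulmx_free_eq0 _ Uf) -[U]trmxK -trmx_mul.
by rewrite colE mulmxA -CE -colE Cr trmx0.
Qed.

Lemma cslice_polyadic n (A' : 'M[F]_(I, n)) (B' : 'M_(J, n)) (C' : 'M_(K, n))
    (L : 'M_(I * J, k)) (U : 'M_(k, K)) (C1 : 'M_(k, R)) :
  row_free U -> unfolding T = L *m U -> L = khatri_rao A B *m C1^T ->
  T = polyadic A' B' C' ->
  forall x, cslice A B C1 x = cslice A' B' (C'^T *m pinvmx U)^T x.
Proof.
move=> Uf E LE TE x; rewrite -!slice_kr -LE trmxK mulmxA.
by rewrite -unfolding_polyadic -TE E mulmxKp.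
Qed.

Lemma has_rank_polyadic : has_rank T R.
Proof.
split=> [|n /sum_of_rank1_polyadic[A' [B' [C' TE]]]].
  have := polyadic_sum_of_rank1 A B C; rewrite -/T.
  suff -> : [set r | [&& col r A != 0, col r B != 0 & col r C != 0]] = setT.
    by rewrite cardsT card_ord.
  apply/setP => r; rewrite !inE kr_C_col_neq0.
  rewrite (col_indep_neq0 k2 kR mk r (kr_compound_indepl rK)).
  by rewrite (col_indep_neq0 k2 kR mk r (kr_compound_indepr rK)).
have [L [U E]] := compression_exists; have [Uf [C1 [Cgp LE CE]]] := compressed E.
have sE := cslice_polyadic Uf E LE TE.
exact (terms_ge Cgp k2 kR mk rK sE).
Qed.

(** Both decompositions are compressed by the same factorization. [compound_full] provides the rank
    condition for the second one, so that [C'] too is recovered from its compression. *)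
Lemma cpd_related (A' : 'M[F]_(I, R)) (B' : 'M_(J, R)) (C' : 'M_(K, R)) :
  is_cpd T A' B' C' -> exists (s : 'S_R) (a b c : 'I_R -> F), forall r,
  [/\ a r * b r * c r = 1, col r A' = a r *: col (s r) A,
      col r B' = b r *: col (s r) B & col r C' = c r *: col (s r) C].
Proof.
case=> _ r1 TE.
have [L [U E]] := compression_exists; have [Uf [C1 [Cgp LE CE]]] := compressed E.
have sE := cslice_polyadic Uf E LE TE.
have rK' := compound_full Cgp k2 kR mk rK sE.
have [|C2 [LE2 CE2]] := compress (kr_row_free m0R rK') Uf (_ : _ *m C'^T = L *m U).
  by rewrite -unfolding_polyadic -TE E.
have {}sE x : cslice A B C1 x = cslice A' B' C2 x.
  by rewrite -!slice_kr -LE -LE2.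
have C20 r : col r C2 != 0.
  have [_ _] := outer_neq0 (r1 r); apply: contra_neq => C2r.
  by rewrite CE2 colE -mulmxA -colE C2r mulmx0.
have [s [a [b [c H]]]] := cpd_match Cgp k2 kR mk rK C20 sE.
exists s, a, b, c => r; have [? ? ? Cr] := H r; split=> //.
rewrite CE2 colE -mulmxA -colE Cr -scalemxAr; congr (_ *: _).
by rewrite CE !colE mulmxA.
Qed.

Lemma cpd_unique_polyadic : cpd_unique T.
Proof.
move=> n A1 A2 B1 B2 C1 C2 cpd1 cpd2.
have nR : n = R.
  have [[h1 h2] _ _] := cpd1; have [g1 g2] := has_rank_polyadic.
  by apply/eqP; rewrite eqn_leq h2 ?g2.
subst n; have [s1 [a1 [b1 [c1 H1]]]] := cpd_related cpd1.
have [s2 [a2 [b2 [c2 H2]]]] := cpd_related cpd2.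
pose t r := (s1^-1 (s2 r))%g.
exists (s2 * s1^-1)%g, (fun r => a2 r / a1 (t r)), (fun r => b2 r / b1 (t r)),
  (fun r => c2 r / c1 (t r)) => r; rewrite permM -/(t r).
have s1t : s1 (t r) = s2 r by rewrite permKV.
have [e1 -> -> ->] := H1 (t r); have [e2 -> -> ->] := H2 r.
have : a1 (t r) * b1 (t r) * c1 (t r) != 0 by rewrite e1 oner_eq0.
rewrite !mulf_eq0 !negb_or => /andP[/andP[a0 b0] c0].
rewrite s1t !scalerA !divfK //; split=> //.
transitivity ((a2 r * b2 r * c2 r) / (a1 (t r) * b1 (t r) * c1 (t r))).
  by field; rewrite a0 b0 c0.
by rewrite e1 e2 divr1.
Qed.
End Uniqueness.
End TensorRank.

(** * Recovering the factors from the flats *)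

Section OrthComplement.
Variable F : realType.

Lemma orth_complement_ex p q d (M : 'M[F]_(p, q)) : (\rank M + d)%N = p ->
  exists X : 'M_(p, d), is_orth_complement M X.
Proof.
move=> rM; have rk : \rank (kermx M) = d by rewrite mxrank_ker; lia.
have [X [rX XM]] : exists X : 'M_(p, d), \rank X = d /\ X^T *m M = 0.
  rewrite -rk; exists (row_base (kermx M))^T; rewrite trmxK mxrank_tr.
  rewrite (eqP (row_base_free _)); split=> //.
  by apply/sub_kermxP; rewrite eq_row_base.
by exists X; split=> //; apply: trmx_inj; rewrite trmx_mul trmxK XM trmx0.
Qed.

Lemma orth_complement_dot p q d (M : 'M[F]_(p, q)) (X : 'M_(p, d)) x y :
  is_orth_complement M X -> X^T *m y = 0 -> M^T *m x = 0 -> dot x y = 0.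
Proof.
move=> [MX rX rM] Xy Mx.
have XM : (X^T <= kermx M)%MS.
  by apply/sub_kermxP/trmx_inj; rewrite trmx_mul trmxK MX trmx0.
have /andP[_ MX'] : (X^T == kermx M)%MS.
  by rewrite -(mxrank_leqif_eq XM) mxrank_tr rX mxrank_ker; lia.
have /submxP[z xz] : (x^T <= X^T)%MS.
  apply: submx_trans MX'; apply/sub_kermxP/trmx_inj.
  by rewrite trmx_mul trmxK Mx trmx0.
by rewrite /dot xz -mulmxA Xy mulmx0 mxE.
Qed.

Lemma orth_complement_line p (M : 'M[F]_p) (a X : 'cV_p) :
  (forall y, M^T *m y = 0 -> exists c, y = c *: a) ->
  is_orth_complement M X -> exists c, c != 0 /\ X = c *: a.
Proof.
move=> My [MX rX _]; have [c Xc] := My X MX; exists c; split=> //.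
by apply: contra_eqN rX => /eqP c0; rewrite Xc c0 scale0r mxrank0.
Qed.

(** Pairing with [y] gives a sum of squared norms. A single orthogonal complement can thus compute
    an intersection of kernels. *)
Lemma gram_kernel p (I : finType) (P : pred I) q (M : I -> 'M[F]_(p, q))
    (y : 'cV_p) :
  (\sum_(i | P i) M i *m (M i)^T)^T *m y = 0 <->
  forall i, P i -> (M i)^T *m y = 0.
Proof.
have -> : (\sum_(i | P i) M i *m (M i)^T)^T *m y =
    \sum_(i | P i) M i *m ((M i)^T *m y).
  rewrite linear_sum mulmx_suml; apply: eq_bigr => i _.
  by rewrite /= trmx_mul trmxK mulmxA.
split=> [E i Pi|H]; last first.
  by rewrite big1 // => i /H ->; rewrite mulmx0.
have dotMM l : dot y (M l *m ((M l)^T *m y)) = dot ((M l)^T *m y) ((M l)^T *m y).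
  by rewrite /dot trmx_mul trmxK -!mulmxA.
have : dot y (\sum_(i | P i) M i *m ((M i)^T *m y)) = 0 by rewrite E dot0r.
rewrite dot_sumr => /eqP; rewrite psumr_eq0 => [/allP H|l _].
  have := H i (mem_index_enum i).
  by rewrite Pi /= dotMM dotxx_eq0 => /eqP.
by rewrite dotMM dotE sumr_ge0 // => a _; rewrite -expr2 sqr_ge0.
Qed.

Lemma gram_unit p q (M : 'M[F]_(p, q)) : row_free M^T -> M^T *m M \in unitmx.
Proof.
move=> Mf; rewrite -row_free_unit; apply: inj_row_free => v vM.
have : dot (M *m v^T) (M *m v^T) = 0.
  by rewrite /dot trmx_mul trmxK mulmxA -(mulmxA v) vM mul0mx mxE.
move/eqP; rewrite dotxx_eq0 => /eqP Mv; apply/eqP.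
by rewrite -(mulmx_free_eq0 _ Mf) -trmx0 -Mv trmx_mul trmxK.
Qed.

End OrthComplement.

(** * Rational nodes, moments and the matrix pencil *)

Section Moments.
Variable F : realType.

Definition powers (k t : nat) : 'cV[rat]_k := \col_i t%:R ^+ i.

(** Pairing with [powers k t] evaluates at [t] a polynomial of size at most [k]; the bound counts
    the roots of the product. Boundedly many rational trials thus replace a generic vector. *)
Lemma dot_powers_neq0 k (I : finType) (P : pred I) (v : I -> 'cV[F]_k) :
  (forall i, P i -> v i != 0) ->
  exists2 t, (t <= #|I| * k)%N &
    forall i, P i -> dot (map_mx ratr (powers k t)) (v i) != 0.
Proof.
move=> v0; pose q i := \poly_(l < k) (if insub l is Some l' then v i l' 0 else 0).
have qE i t : (q i).[t%:R] = dot (map_mx ratr (powers k t)) (v i).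
  rewrite horner_poly dotE; apply: eq_bigr => l _.
  by rewrite !mxE valK rmorphXn rmorph_nat mulrC.
have q0 i : P i -> q i != 0.
  move=> Pi; apply: contraNneq (v0 i Pi) => q0; apply/eqP/colP => l.
  have := congr1 (fun p : {poly F} => p`_l) q0.
  by rewrite /= coef_poly coef0 ltn_ord valK mxE.
have [|t tp ptn] := @poly_nonroot _ (\prod_(i | P i) q i).
  by apply/prodf_neq0.
exists t; last first.
  move=> i Pi; rewrite -qE; move: ptn; rewrite horner_prod => /prodf_neq0.
  by apply.
move: tp; have := size_prod_leq P q; set sz := size _; move=> sp tp.
have : (\sum_(i | P i) size (q i) <= #|I| * k)%N.
  apply: leq_trans (_ : \sum_(i | P i) k <= _)%N.
    by apply: leq_sum => i _; apply: size_poly.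
  by rewrite sum_nat_const leq_mul2r max_card orbT.
by lia.
Qed.

End Moments.

(* The [T]-th column of [node_mx] lies on the hyperplanes of the moment curve
   that are not indexed by [T]; these points are unisolvent for the forms of
   degree [m]. *)
Definition node_mx k R m : 'M[rat]_(k, 'C(R.+1, m)) :=
  \matrix_(i, T) flat (vandermonde rat k R.+1) (~: kset T) i 0.

(** The test forms are all products of [m.-1] columns of the moment curve: a spanning set that is
    rational and independent of the data. *)
Definition node_values k R m : 'M[rat]_('C(R.+1, m.-1), 'C(R.+1, m)) :=
  \matrix_(V, T) pev (vandermonde rat k R.+1) (kset V) (col T (node_mx k R m)).

Definition weight_row k R m t : 'rV[rat]_('C(R.+1, m)) :=
  \row_T dot (powers k t) (col T (node_mx k R m)).

Section Core.
Variables (F : realType) (k R m : nat) (C : 'M[F]_(k, R)).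
Hypotheses (Cgp : general_position C) (k2 : (2 <= k)%N) (kR : (k <= R)%N).
Hypothesis mk : (m + k = R.+2)%N.

Local Notation n := 'C(R.+1, m).
Local Notation d := 'C(R, m.-1).
Local Notation D := (vandermonde F k R.+1).

Let k0 : (0 < k)%N. Proof. lia. Qed.
Let Dgp : general_position D := @vandermonde_general_position F k R.+1.

Definition node (T : 'I_n) : 'cV[F]_k := map_mx ratr (col T (node_mx k R m)).
Definition cflat (V : 'I_d) : 'cV[F]_k := flat C (~: kset V).

Lemma map_vandermonde : map_mx ratr (vandermonde rat k R.+1) = D.
Proof. by apply/matrixP => i t; rewrite !mxE rmorphXn rmorph_nat. Qed.

Lemma ratr_dot (u x : 'cV[rat]_k) :
  ratr (dot u x) = dot (map_mx ratr u) (map_mx ratr x) :> F.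
Proof. by rewrite !dotE rmorph_sum; apply: eq_bigr => i _; rewrite !mxE rmorphM. Qed.

Lemma ratr_pev (V : {set 'I_R.+1}) (x : 'cV[rat]_k) :
  ratr (pev (vandermonde rat k R.+1) V x) = pev D V (map_mx ratr x) :> F.
Proof.
rewrite rmorph_prod; apply: eq_bigr => r _.
by rewrite /= !ev_dot ratr_dot -map_vandermonde map_col.
Qed.

Lemma col_node_mx T : col T (node_mx k R m) = flat (vandermonde rat k R.+1) (~: kset T).
Proof. by apply/colP => i; rewrite !mxE. Qed.

Lemma card_node (T : 'I_n) : #|~: kset T| = k.-1.
Proof. by rewrite card_setC_ord card_kset; lia. Qed.

Lemma zeros_node T : zeros D (node T) = ~: kset T.
Proof.
rewrite -map_vandermonde /node map_zeros col_node_mx zeros_flat ?card_node //.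
exact: vandermonde_general_position.
Qed.

Lemma node_neq0 T : node T != 0.
Proof.
rewrite map_mx_eq0 col_node_mx flat_neq0 // card_node; lia.
Qed.

Lemma card_cflat (V : 'I_d) : #|~: kset V| = k.-1.
Proof. by rewrite card_setC_ord card_kset; lia. Qed.

Lemma zeros_cflat V : zeros C (cflat V) = ~: kset V.
Proof. by rewrite zeros_flat ?card_cflat. Qed.

Lemma cflat_neq0 V : cflat V != 0.
Proof. by rewrite flat_neq0 // card_cflat; lia. Qed.

(** The nodes come from rational flats and match the flats over [F] only up to nonzero scalars,
    which homogeneity absorbs. *)
Lemma node_form_eq0 (h : 'cV[F]_k -> F) : form D m h ->
  (forall T, h (node T) = 0) -> forall x, h x = 0.
Proof.
move=> fh h0.
have gz T : exists c, node T = c *: flat D (~: kset T).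
  by apply: flat_uniq; rewrite ?card_node ?zeros_node //; lia.
apply: (form_eq0 Dgp _ k0 fh); first lia.
move=> S cS; have [T TE] : exists T, @kset m R.+1 T = ~: S.
  by apply: kset_surj; rewrite card_setC_ord cS; lia.
have [c nE] := gz T; rewrite TE setCK in nE.
have c0 : c != 0 by apply: contraNneq (node_neq0 T) => c0; rewrite nE c0 scale0r.
have := h0 T; rewrite nE (form_homog _ _ fh) => /eqP.
by rewrite mulf_eq0 expf_eq0 (negPf c0) andbF => /eqP.
Qed.

Definition product_mx : 'M[F]_('C(R, m), n) := \matrix_(T, i) pev C (kset T) (node i).

Lemma product_mx_free : row_free product_mx.
Proof.
apply: inj_row_free => y yP; apply/rowP => T0; rewrite [RHS]mxE.
pose idx (S : {set 'I_R}) := if [pick T | kset T == S] is Some T then y 0 T else 0.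
have idxE T : idx (kset T) = y 0 T.
  by rewrite /idx; case: pickP => [T' /eqP/kset_inj->|/(_ T)] //; rewrite eqxx.
rewrite -idxE; apply: (pev_free Cgp k2 kR mk) (card_kset T0) => x.
rewrite -(big_kset m (fun S : {set 'I_R} => idx S * pev C S x)).
move: x; apply: node_form_eq0.
  apply: form_sum => T _; apply: formZ.
  by have := pev_form C (V := kset T) Dgp; rewrite card_kset; apply; lia.
move=> T; have /rowP/(_ T) := yP; rewrite !mxE => E; rewrite -[RHS]E.
by apply: eq_bigr => T' _; rewrite idxE mxE.
Qed.

(** Each column of [Z] is a functional to which [functional_flats] applies; [beta] collects the
    coefficients. A combination that [beta] sends to zero kills the products dual to the nodes, so
    its node coefficients vanish. *)
Lemma kernel_structure (Z : 'M[F]_(n, d)) :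
  product_mx *m Z = 0 -> row_free Z^T ->
  exists2 beta : 'M[F]_d, beta \in unitmx & forall w h, form C m.-1 h -> forall i,
    \sum_T Z T i * (dot w (node T) * h (node T)) =
    \sum_V beta V i * (dot w (cflat V) * h (cflat V)).
Proof.
move=> PZ Zf.
have mj : m.-1.+1 = m by lia.
have /fin_all_exists[b Hb] i : exists b : {set 'I_R} -> F, forall w h,
    form C m.-1 h -> \sum_T Z T i * (dot w (node T) * h (node T)) =
    \sum_(V : {set 'I_R} | #|V| == m.-1)
       b V * (dot w (flat C (~: V)) * h (flat C (~: V))).
  apply: (functional_flats Cgp k2 kR); first lia.
  move=> S; rewrite mj => /kset_surj[T <-].
  have /matrixP/(_ T i) := PZ; rewrite !mxE => E; rewrite -[RHS]E.
  by apply: eq_bigr => T' _; rewrite mxE mulrC.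
pose beta : 'M[F]_d := \matrix_(V, i) b i (kset V).
have betaE w h i : form C m.-1 h ->
    \sum_T Z T i * (dot w (node T) * h (node T)) =
    \sum_V beta V i * (dot w (cflat V) * h (cflat V)).
  move=> fh; rewrite Hb // -(big_kset m.-1 (fun V : {set 'I_R} =>
    b i V * (dot w (flat C (~: V)) * h (flat C (~: V))))).
  by apply: eq_bigr => V _; rewrite mxE.
exists beta; last by move=> w h fh i; apply: betaE.
rewrite -unitmx_tr -row_free_unit; apply: inj_row_free => y yb.
apply/eqP; rewrite -(mulmx_free_eq0 _ Zf); apply/eqP/rowP => T.
have zh w h : form C m.-1 h ->
    \sum_T' (y *m Z^T) 0 T' * (dot w (node T') * h (node T')) = 0.
  move=> fh; transitivity (\sum_i y 0 i * \sum_T' Z T' i * (dot w (node T') * h (node T'))).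
    under eq_bigr do rewrite mxE mulr_suml.
    rewrite exchange_big; apply: eq_bigr => i _; rewrite mulr_sumr.
    by apply: eq_bigr => T' _; rewrite [_^T _ _]mxE -mulrA.
  transitivity (\sum_V (y *m beta^T) 0 V * (dot w (cflat V) * h (cflat V))).
    under [RHS]eq_bigr do rewrite mxE mulr_suml.
    rewrite [RHS]exchange_big; apply: eq_bigr => i _; rewrite betaE // mulr_sumr.
    by apply: eq_bigr => V _; rewrite [_^T _ _]mxE -mulrA.
  by rewrite yb big1 // => V _; rewrite mxE mul0r.
have [r rT] : exists r, r \in kset T.
  by apply/set0Pn; rewrite -card_gt0 card_kset; lia.
have cT : #|kset T :\ r| = m.-1.
  by have := cardsD1 r (kset T); rewrite rT card_kset add1n => E; rewrite [in RHS]E.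
have fh : form C m.-1 (pev D (kset T :\ r)).
  by have := pev_form D (V := kset T :\ r) Cgp; rewrite cT; apply; lia.
(* Together the linear form and [pev D (kset T :\ r)] give the product over [kset T], which among
   the nodes is nonzero only at the [T]-th. *)
have := zh (col r D) _ fh; rewrite (bigD1 T) //= big1 ?addr0 => [/eqP|T' TT'].
  rewrite -ev_dot -pev_setU1 ?setD11 // setD1K // mulf_eq0.
  rewrite [X in _ || X](_ : _ = false) ?orbF => [/eqP->|]; first by rewrite mxE.
  apply/negbTE; rewrite pev_neq0 zeros_node disjoints_subset setCK //.
rewrite -ev_dot -pev_setU1 ?setD11 // setD1K //.
apply/eqP; rewrite mulf_eq0; apply/orP; right; apply: contraNT TT'.
rewrite pev_neq0 zeros_node disjoints_subset setCK => sT.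
by rewrite eq_sym -(inj_eq (@kset_inj _ _)) eqEcard sT !card_kset leqnn.
Qed.

Section Pencil.
Variable Z : 'M[F]_(n, d).
Variable beta : 'M[F]_d.
Hypothesis bu : beta \in unitmx.
Hypothesis Zbeta : forall w h, form C m.-1 h -> forall i,
    \sum_T Z T i * (dot w (node T) * h (node T)) =
    \sum_V beta V i * (dot w (cflat V) * h (cflat V)).

Local Notation W t := (map_mx ratr (powers k t) : 'cV[F]_k).

(** The functionals in [Z], applied to the test forms times the linear form [powers k t]. *)
Definition moment t : 'M[F]_('C(R.+1, m.-1), d) :=
  map_mx ratr (node_values k R m *m diag_mx (weight_row k R m t)) *m Z.

Definition flat_weights t : 'rV[F]_d := \row_V dot (W t) (cflat V).

Definition flat_values : 'M[F]_('C(R.+1, m.-1), d) :=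
  \matrix_(S, V) pev D (kset S) (cflat V).

Lemma momentE t : moment t = flat_values *m diag_mx (flat_weights t) *m beta.
Proof.
apply/matrixP => S i; rewrite /moment [LHS]mxE.
have fS : form C m.-1 (pev D (kset S)).
  by have := pev_form D (V := kset S) Cgp; rewrite card_kset; apply; lia.
transitivity (\sum_T Z T i * (dot (W t) (node T) * pev D (kset S) (node T))).
  apply: eq_bigr => T _; rewrite mul_mx_diag [map_mx _ _ _ _]mxE [X in ratr X]mxE.
  rewrite [node_values _ _ _ _ _]mxE [weight_row _ _ _ _ _ _]mxE.
  by rewrite rmorphM /= ratr_pev ratr_dot; ring.
rewrite Zbeta // [RHS]mxE; apply: eq_bigr => V _; rewrite mul_mx_diag [in RHS]mxE.
by rewrite [flat_values _ _]mxE [flat_weights _ _ _]mxE; ring.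
Qed.

(** The test forms span the forms of degree [m.-1], among them the products [pev C (kset V)], which
    separate the flats. *)
Lemma flat_values_free : row_free flat_values^T.
Proof.
apply: inj_row_free => y yF; apply/rowP => V; rewrite [RHS]mxE.
have cV : #|kset V| = m.-1 by rewrite card_kset.
have [|c Hc] := pev_form C (V := kset V) Dgp; first by rewrite cV; lia.
have : \sum_V' y 0 V' * pev C (kset V) (cflat V') = 0.
  under eq_bigr do rewrite Hc mulr_sumr.
  rewrite exchange_big big1 //= => S; rewrite cV => /eqP cS.
  have [S' SE] : exists S', @kset m.-1 R.+1 S' = S by apply: kset_surj.
  have /rowP/(_ S') := yF; rewrite !mxE => E.
  rewrite -[RHS](mulr0 (c S)) -[X in _ = _ * X]E mulr_sumr; apply: eq_bigr => V' _.
  by rewrite !mxE SE mulrCA.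
rewrite (bigD1 V) //= big1 ?addr0 => [/eqP|V' VV'].
  rewrite mulf_eq0 [X in _ || X](_ : _ = false) ?orbF => [/eqP//|].
  by apply/negbTE; rewrite pev_neq0 zeros_cflat disjoints_subset setCK.
apply/eqP; rewrite mulf_eq0; apply/orP; right; apply: contraNT VV'.
rewrite pev_neq0 zeros_cflat disjoints_subset setCK => sV.
by rewrite eq_sym -(inj_eq (@kset_inj _ _)) eqEcard sV !card_kset leqnn.
Qed.

Variables t1 t2 : nat.
Hypothesis t1P : forall V, dot (W t1) (cflat V) != 0.
Hypothesis t2P : forall V V', V != V' ->
  dot (W t1) (cflat V) * dot (W t2) (cflat V') !=
  dot (W t1) (cflat V') * dot (W t2) (cflat V).

Lemma unit_flat_weights : diag_mx (flat_weights t1) \in unitmx.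
Proof.
rewrite unitmxE det_diag unitfE; apply/prodf_neq0 => V _.
by rewrite mxE t1P.
Qed.

Local Notation E1 := ((moment t1)^T *m moment t1).
Local Notation E2 := ((moment t1)^T *m moment t2).

(** Multiplying by [(moment t1)^T] makes the pencil square; [H] is invertible because a Gram matrix
    of independent real columns is. *)
Let H := (moment t1)^T *m flat_values.

Let Hu : H \in unitmx.
Proof.
rewrite /H momentE !trmx_mul tr_diag_mx -!mulmxA unitmx_mul unitmx_tr bu.
by rewrite unitmx_mul unit_flat_weights gram_unit // flat_values_free.
Qed.

Let E1E : E1 = H *m diag_mx (flat_weights t1) *m beta.
Proof. by rewrite {2}momentE !mulmxA. Qed.

Let E2E : E2 = H *m diag_mx (flat_weights t2) *m beta.
Proof. by rewrite (momentE t2) !mulmxA. Qed.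

Lemma gevd_ex : exists X a b, is_gevd E1 E2 X a b.
Proof.
exists (invmx beta), (flat_weights t1), (flat_weights t2); split.
- exists 1, 0; rewrite scale1r scale0r addr0 E1E unitmx_mul bu andbT.
  by rewrite unitmx_mul Hu unit_flat_weights.
- by rewrite unitmx_inv.
- by move=> V; rewrite mxE t1P.
rewrite E1E E2E !mulmxK // -!mulmxA !mulmx_diag; congr (_ *m (_ *m diag_mx _)).
by apply/rowP => V; rewrite !mxE mulrC.
Qed.

(* In the coordinates [beta *m X] the pencil is diagonal and its generalized
   eigenvalues are distinct. *)
Lemma gevd_columns X a b : is_gevd E1 E2 X a b ->
  exists tau : 'I_d -> 'I_d, forall V, exists c, c != 0 /\
    col (tau V) (beta *m X) = c *: delta_mx V 0.
Proof.
move=> [_ Xu ab]; rewrite E1E E2E -!mulmxA => E.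
have [Q QX] : exists Q, Q = beta *m X by exists (beta *m X).
have Qu : Q \in unitmx by rewrite QX unitmx_mul bu.
have QE V i : dot (W t1) (cflat V) * b 0 i * Q V i =
    dot (W t2) (cflat V) * a 0 i * Q V i.
  have : diag_mx (flat_weights t1) *m (Q *m diag_mx b) =
         diag_mx (flat_weights t2) *m (Q *m diag_mx a).
    apply: (can_inj (mulKmx Hu)); rewrite QX -!mulmxA; exact: E.
  move/matrixP/(_ V i); rewrite !mul_mx_diag !mul_diag_mx !mxE => E'.
  by rewrite mulrAC -mulrA E'; ring.
(* Two nonzero entries in one column would give two flats with the same eigenvalue, against
   [t2P]. *)
have one V V' i : Q V i != 0 -> Q V' i != 0 -> V = V'.
  move=> QV QV'; apply/eqP; apply: contraT => /t2P.
  have /(mulIf QV) e := QE V i; have /(mulIf QV') e' := QE V' i.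
  case/negP; apply/eqP.
  have /orP[a0|b0] := ab i.
    apply: (mulIf a0); rewrite -mulrA -e'.
    by rewrite -[RHS]mulrA -e; ring.
  apply: (mulIf b0).
  rewrite [LHS](_ : _ = dot (W t2) (cflat V') *
      (dot (W t1) (cflat V) * b 0 i)); last by ring.
  rewrite [RHS](_ : _ = dot (W t2) (cflat V) *
      (dot (W t1) (cflat V') * b 0 i)); last by ring.
  by rewrite e e'; ring.
have /fin_all_exists[tau tauP] V : exists i, Q V i != 0.
  apply/existsP; apply: contraT; rewrite negb_exists => /forallP Q0.
  have : delta_mx 0 V *m Q = 0 :> 'rV_d.
    rewrite -rowE; apply/rowP => i; rewrite !mxE; apply/eqP.
    by have := Q0 i; rewrite negbK.
  rewrite -(mul0mx _ Q) => /(can_inj (mulmxK Qu))/rowP/(_ V)/eqP.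
  by rewrite !mxE !eqxx oner_eq0.
exists tau => V; exists (Q V (tau V)); split=> //; apply/colP => V'.
rewrite -QX [LHS]mxE [RHS]mxE [X in _ = _ * X]mxE eqxx andbT.
have [->|VV'] := eqVneq V' V; first by rewrite mulr1.
rewrite mulr0; apply/eqP; apply: contraT => /one/(_ (tauP V)) E'.
by rewrite E' eqxx in VV'.
Qed.

(** The functionals applied to each coordinate times the [m.-1]-st power of a linear form. Since [X]
    isolates single flats, the values are their coordinates up to a scalar. *)
Definition flat_estimates (X : 'M[F]_d) : 'M[F]_(k, d) :=
  map_mx ratr (node_mx k R m *m
    diag_mx (\row_T (weight_row k R m t1 0 T) ^+ m.-1)) *m Z *m X.

Lemma flat_estimatesP X a b : is_gevd E1 E2 X a b ->
  exists tau : 'I_d -> 'I_d, forall V, exists c, c != 0 /\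
    col (tau V) (flat_estimates X) = c *: cflat V.
Proof.
case/gevd_columns => tau tauP; exists tau => V; have [c [c0 Hc]] := tauP V.
exists (dot (W t1) (cflat V) ^+ m.-1 * c).
split; first by rewrite mulf_neq0 // expf_neq0.
have E : map_mx ratr (node_mx k R m *m
    diag_mx (\row_T (weight_row k R m t1 0 T) ^+ m.-1)) *m Z =
  \matrix_(i, V) (cflat V i 0 * dot (W t1) (cflat V) ^+ m.-1) *m beta.
  apply/matrixP => i l; rewrite [LHS]mxE.
  transitivity (\sum_T Z T l * (dot (delta_mx i 0) (node T) * dot (W t1) (node T) ^+ m.-1)).
    apply: eq_bigr => T _; rewrite mul_mx_diag [map_mx _ _ _ _]mxE [X in ratr X]mxE.
    rewrite [(\row__ _) _ _]mxE [weight_row _ _ _ _ _ _]mxE rmorphM rmorphXn /=.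
    rewrite ratr_dot (dotC (delta_mx i 0)) dot_delta mulrC.
    by rewrite /node [X in _ = _ * (X * _)]mxE [X in _ = _ * (ratr X * _)]mxE.
  rewrite (Zbeta _ (form_exp _ Cgp _)); last by lia.
  rewrite [RHS]mxE; apply: eq_bigr => V' _; by rewrite mxE (dotC (delta_mx i 0)) dot_delta; ring.
rewrite /flat_estimates E -mulmxA colE -mulmxA -colE Hc -scalemxAr.
rewrite -colE mulrC -scalerA; congr (_ *: _).
by apply/colP => i; rewrite !mxE mulrC.
Qed.
End Pencil.
End Core.

(** * The factors as orthogonal complements *)

Section Recovery.
Variables (F : realType) (k R m : nat) (C : 'M[F]_(k, R)).
Hypotheses (Cgp : general_position C) (k2 : (2 <= k)%N) (kR : (k <= R)%N).
Hypothesis mk : (m + k = R.+2)%N.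

Local Notation n := 'C(R.+1, m).
Local Notation d := 'C(R, m.-1).
Local Notation f := (@cflat F k R m C).
Local Notation W t := (map_mx ratr (powers k t) : 'cV[F]_k).

(** The first linear form must vanish at no flat, and the ratio of the two must separate the flats.
    The vectors [v] are nonzero since distinct flats have different zeros. *)
Lemma weights_ex : exists t1 t2, [/\ (t1 <= d * k)%N, (t2 <= d * d * k)%N,
  forall V, dot (W t1) (f V) != 0 &
  forall V V', V != V' ->
    dot (W t1) (f V) * dot (W t2) (f V') != dot (W t1) (f V') * dot (W t2) (f V)].
Proof.
have [|t1 t1b t1P] := @dot_powers_neq0 F k 'I_d predT f.
  by move=> V _; apply: cflat_neq0.
pose v (u : 'I_d * 'I_d) :=
  dot (W t1) (f u.1) *: f u.2 - dot (W t1) (f u.2) *: f u.1.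
have [|t2 t2b t2P] :=
    @dot_powers_neq0 F k ('I_d * 'I_d)%type (fun u => u.1 != u.2) v.
  move=> [V V'] /= VV'; rewrite subr_eq0; apply: contra_neq VV' => /(congr1 (zeros C)).
  by rewrite !zerosZ ?t1P // !zeros_cflat // => /(can_inj (@setCK _))/kset_inj.
exists t1, t2; split.
- by rewrite card_ord in t1b.
- by rewrite card_prod !card_ord in t2b.
- by move=> V; apply: t1P.
move=> V V' VV'; have := t2P (V, V') VV'.
by rewrite dotBr !dotZr subr_eq0.
Qed.

Section Estimates.
Variable fh : 'I_d -> 'cV[F]_k.
Hypothesis fhP : forall V, exists c, c != 0 /\ fh V = c *: f V.

Lemma third_factor_gram (r : 'I_R) (G : 'M[F]_k) :
  G = \sum_(V : 'I_d | r \notin kset V) fh V *m (fh V)^T ->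
  (\rank G + 1)%N = k /\ forall X : 'cV_k, is_orth_complement G X ->
    exists c, c != 0 /\ X = c *: col r C.
Proof.
move=> GE.
have k0 : (0 < k)%N by lia.
have Ga : G^T *m col r C = 0.
  rewrite GE; apply/gram_kernel => V rV; have [c [c0 ->]] := fhP V.
  have : r \in zeros C (f V) by rewrite zeros_cflat // inE.
  rewrite inE ev_dot dotC /dot => /eqP E; apply/matrixP => i j.
  by rewrite !ord1 linearZ /= -scalemxAl mxE E mulr0 mxE.
have Gy y : G^T *m y = 0 -> exists c, y = c *: col r C.
  rewrite GE => /gram_kernel H; apply: (third_factor_line Cgp k2 kR mk) => S cS rS.
  have [V VE] : exists V, @kset m.-1 R V = ~: S.
    by apply: kset_surj; rewrite card_setC_ord cS; lia.
  have [c [c0 fE]] := fhP V.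
  have /matrixP/(_ 0 0) : (fh V)^T *m y = 0 by apply: H; rewrite VE inE rS.
  rewrite fE linearZ /= -scalemxAl mxE [RHS]mxE => /eqP.
  rewrite mulf_eq0 (negPf c0) /= /cflat VE setCK => /eqP.
  by rewrite dotC.
split; last by move=> X; apply: orth_complement_line.
exact: rank_kernel_line (gp_col_neq0 Cgp r kR k0) Ga Gy.
Qed.

Variables (I J : nat) (A : 'M[F]_(I, R)) (B : 'M[F]_(J, R)).
Hypothesis rK : \rank (khatri_rao (compound m A) (compound m B)) = 'C(R, m).
Variable L : 'M[F]_(I * J, k).
Hypothesis LE : L = khatri_rao A B *m C^T.

Let Ai := kr_compound_indepl rK.
Let Bi := kr_compound_indepr rK.

Let zfh V : zeros C (fh V) = ~: kset V.
Proof. by have [c [c0 ->]] := fhP V; rewrite zerosZ // zeros_cflat. Qed.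

Let cV (V : 'I_d) : #|~: kset V| = k.-1.
Proof. by rewrite card_setC_ord card_kset; lia. Qed.

Lemma rank_slice V : (\rank (slice L (fh V)) + (I - m.-1))%N = I.
Proof.
have rE : \rank (slice L (fh V)) = m.-1.
  by rewrite LE slice_kr (rank_cslice k2 kR mk Ai Bi (cV V) (zfh V)).
by rewrite -{1}rE subnKC // rank_leq_row.
Qed.

(** Orthogonality to the left kernels [Nn V] with [r \in kset V] means lying in all the
    corresponding ranges; [factor_line] leaves only the line of [col r A]. *)
Lemma first_factor_gram (r : 'I_R) (Nn : 'I_d -> 'M[F]_(I, I - m.-1)) (G : 'M[F]_I) :
  (forall V, is_orth_complement (slice L (fh V)) (Nn V)) ->
  G = \sum_(V : 'I_d | r \in kset V) Nn V *m (Nn V)^T ->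
  (\rank G + 1)%N = I /\ forall X : 'cV_I, is_orth_complement G X ->
    exists c, c != 0 /\ X = c *: col r A.
Proof.
move=> Noc GE.
have ker V x := left_kernel k2 kR mk A x Bi (cV V) (zfh V).
have Ga : G^T *m col r A = 0.
  rewrite GE; apply/gram_kernel => V rV; have [+ _ _] := Noc V.
  rewrite LE slice_kr => EN; apply/matrixP => i j; rewrite ord1 [RHS]mxE.
  have /ker : (cslice A B C (fh V))^T *m col i (Nn V) = 0.
    by rewrite colE mulmxA EN mul0mx.
  move=> /(_ r); rewrite inE negbK => /(_ rV); rewrite /dot => E; rewrite -[RHS]E.
  by rewrite !mxE; apply: eq_bigr => a _; rewrite !mxE.
have Gy y : G^T *m y = 0 -> exists c, y = c *: col r A.
  rewrite GE => /gram_kernel H; apply: (factor_line k2 kR mk Ai) => S cS rS x xS.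
  have [V VE] : exists V, @kset m.-1 R V = ~: S.
    by apply: kset_surj; rewrite card_setC_ord cS; lia.
  apply: (orth_complement_dot (Noc V)); first by apply: H; rewrite VE inE.
  by rewrite LE slice_kr; apply/ker; rewrite VE setCK.
split; last by move=> X; apply: orth_complement_line.
exact: rank_kernel_line (col_indep_neq0 k2 kR mk r Ai) Ga Gy.
Qed.

(** The samples are the image of [product_mx] under an injective matrix, so they have the same null
    space; its dimension follows from Pascal's rule. *)
Lemma compound_samples (Rm : 'M[F]_('C(I, m) * 'C(J, m), n)) :
  (forall T, col T Rm = vec (compound m (slice L (@node F k R m T)))) ->
  (\rank Rm^T + d)%N = n /\ forall Z : 'M_(n, d), is_orth_complement Rm^T Z ->
    product_mx m C *m Z = 0 /\ row_free Z^T.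
Proof.
move=> RT.
have RE : Rm = khatri_rao (compound m A) (compound m B) *m product_mx m C.
  apply/matrixP => i T; have /colP/(_ i) := RT T; rewrite LE slice_kr.
  rewrite vec_compound_cslice [LHS]mxE => ->; rewrite [LHS]mxE [RHS]mxE.
  by apply: eq_bigr => T' _; congr (_ * _); rewrite !mxE.
have rR : \rank Rm = 'C(R, m).
  by rewrite RE -mxrank_tr trmx_mul mxrankMfree ?mxrank_tr;
    [exact/eqP/product_mx_free | rewrite /row_free mxrank_tr rK].
split=> [|Z [MZ rZ _]].
  by rewrite mxrank_tr rR -[in RHS](prednK (_ : 0 < m)%N) ?binS ?prednK //; lia.
split; last by rewrite /row_free mxrank_tr rZ.
by apply: (full_rank_mulmx0 rK); rewrite mulmxA -RE -[Rm]trmxK.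
Qed.
End Estimates.
End Recovery.

(** * Programs *)

Section Expressions.
Variable F : realType.
Implicit Types s : store F.

Definition tr m n (e : expr m n) : expr n m := Gather (fun i j => (j, i)) e.

Definition unvec I J (e : expr (I * J) 1) : expr I J :=
  Gather (fun i j => (mxtens_index (i, j), ord0)) e.

Definition evec p q (e : expr p q) : expr (p * q) 1 :=
  Gather (fun i _ => mxtens_unindex i) e.

Definition ecol p q (j : 'I_q) (e : expr p q) : expr p 1 :=
  Gather (fun i _ => (i, j)) e.

Definition esum (I : finType) (P : pred I) m n (e : I -> expr m n) : expr m n :=
  foldr (fun i => Add (e i)) (Const 0) [seq i <- enum I | P i].

Definition ecols m R (e : 'I_R -> expr m 1) : expr m R :=
  esum predT (fun r => Mul (e r) (Const (delta_mx 0 r))).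

Definition egram (I : finType) (P : pred I) m n (e : I -> expr m n) : expr m m :=
  esum P (fun i => Mul (e i) (tr (e i))).

Lemma eval_mul s m n p (e1 : expr m n) (e2 : expr n p) :
  eval s (Mul e1 e2) = eval s e1 *m eval s e2.
Proof. by []. Qed.

Lemma eval_compound s k m n (e : expr m n) :
  eval s (Compound k e) = compound k (eval s e).
Proof. by []. Qed.

Lemma eval_tr s m n (e : expr m n) : eval s (tr e) = (eval s e)^T.
Proof. by apply/matrixP => i j; rewrite !mxE. Qed.

Lemma eval_unvec s I J k (L : expr (I * J) k) (x : expr k 1) :
  eval s (unvec (Mul L x)) = slice (eval s L) (eval s x).
Proof. by apply/matrixP => i j; rewrite !mxE. Qed.

Lemma eval_evec s p q (e : expr p q) : eval s (evec e) = vec (eval s e).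
Proof. by apply/matrixP => i j; rewrite !mxE. Qed.

Lemma eval_ecol s p q j (e : expr p q) : eval s (ecol j e) = col j (eval s e).
Proof. by apply/matrixP => i l; rewrite !mxE. Qed.

Lemma eval_esum s (I : finType) (P : pred I) m n (e : I -> expr m n) :
  eval s (esum P e) = \sum_(i | P i) eval s (e i).
Proof.
transitivity (\sum_(i <- enum I | P i) eval s (e i)); last first.
  by rewrite big_enum_cond; apply: eq_bigl.
rewrite /esum -big_filter.
elim: [seq _ <- _ | _] => [|i r IH] /=; first by rewrite big_nil map_mx0.
by rewrite big_cons IH.
Qed.

Lemma eval_ecols s m R (e : 'I_R -> expr m 1) r :
  col r (eval s (ecols e)) = eval s (e r).
Proof.
rewrite eval_esum; apply/colP => i; rewrite mxE summxE (bigD1 r) //= big1 ?addr0.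
  by rewrite mxE big_ord1 !mxE !eqxx rmorph1 mulr1.
move=> v vr; rewrite mxE big_ord1 !mxE (eq_sym r) (negPf vr) andbF rmorph0.
by rewrite mulr0.
Qed.

Lemma eval_egram s (I : finType) (P : pred I) m n (e : I -> expr m n) :
  eval s (egram P e) = \sum_(i | P i) eval s (e i) *m (eval s (e i))^T.
Proof. by rewrite eval_esum; apply: eq_bigr => i _; rewrite eval_mul eval_tr. Qed.

End Expressions.

Section Programs.
Variables (F : realType) (I J K : nat).
Local Notation prog := (program I J K).
Implicit Types (s : store F) (p : prog).

Lemma upd_same s x m n (M : 'M[F]_(m, n)) : upd s x M x m n = M.
Proof. by rewrite /upd eqxx conform_mx_id. Qed.

Lemma upd_other s x m n (M : 'M[F]_(m, n)) y : y != x -> upd s x M y = s y.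
Proof. by rewrite /upd => /negPf->. Qed.

Lemma outcome_ex p s : exists o, outcome p s o.
Proof.
elim: p s => [n A B C|c p IH|p1 IH1 p2 IH2] s /=; first by eexists.
  have [[s' cs]|no] := EM (exists s', step c s s').
    by have [o po] := IH s'; exists o; left; exists s'.
  by exists None; right; split=> // s' cs; apply: no; exists s'.
have [[f|] o1] := IH1 s; first by exists (Some f); left.
by have [o o2] := IH2 s; exists o; right.
Qed.

(** Instructions may return any admissible result, so no sequence of choices may lead to failure. *)
Definition nofail p s : Prop := ~ outcome p s None.

Lemma nofail_do c p s : (exists s', step c s s') ->
  (forall s', step c s s' -> nofail p s') -> nofail (Do c p) s.
Proof.
move=> [s' cs] H [[s'' cs' o]|[no _]]; last exact: no cs.
exact: H cs' o.
Qed.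

Lemma nofail_orelse p1 p2 s : nofail p1 s \/ nofail p2 s -> nofail (OrElse p1 p2) s.
Proof. by case=> H [[//]|[o1 o2]]; apply: H. Qed.

(** An exhausted list has to fail, hence the check that the unit matrix is zero. *)
Definition any_of (X : eqType) (p : X -> prog) (l : seq X) : prog :=
  foldr (fun x => OrElse (p x))
    (Do (CheckZero (Const (1%:M : 'M_1)))
       (Return (Const (0 : 'M_(I, 0))) (Const 0) (Const 0))) l.

Lemma nofail_any (X : eqType) (p : X -> prog) l x s :
  x \in l -> nofail (p x) s -> nofail (any_of p l) s.
Proof.
elim: l => //= y l IH; rewrite inE => /orP[/eqP<-|xl] H.
  by apply: nofail_orelse; left.
by apply: nofail_orelse; right; apply: IH.
Qed.

Lemma any_of_outcome (p : nat -> prog) i l x s o : (i <= x < i + l)%N ->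
  nofail (p x) s -> outcome (any_of p (iota i l)) s o ->
  exists y f, [/\ (y <= x)%N, o = Some f & outcome (p y) s o].
Proof.
elim: l i => [|l IH] i ix px /=; first lia.
case=> [[+ oi]|[oi ol]].
  by case: o oi {IH} => // f oi _; exists i, f; split=> //; lia.
have [ix'|ix'] := eqVneq i x; first by case: px; rewrite -ix'.
by apply: (IH i.+1) => //; lia.
Qed.

Section Sound.
Variables (T : tensor F I J K) (R : nat).

(** Partial correctness from any store that holds the tensor: this rules out that unsuitable weights
    or labellings return a wrong decomposition. *)
Definition sound p : Prop := forall s f, s 0%N (I * J)%N K = unfolding T ->
  outcome p s (Some f) ->
  nterms f = R /\ T = polyadic (factorA f) (factorB f) (factorC f).

Definition writes (c : instr) : seq nat :=
  match c with
  | Assign x _ _ _ => [:: x]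
  | CheckZero _ _ _ => [::]
  | Solve x _ _ _ _ _ => [:: x]
  | OrthComplement x _ _ _ _ => [:: x]
  | RankFactor x y _ _ _ _ => [:: x; y]
  | FactorQR x y _ _ _ => [:: x; y]
  | FactorSVD x y z _ _ _ => [:: x; y; z]
  | GEVD x y z _ _ _ => [:: x; y; z]
  end.

Lemma step_frame c s s' x : step c s s' -> x \notin writes c -> s' x = s x.
Proof.
case: c => /=.
- by move=> y m n e ->; rewrite inE => /upd_other->.
- by move=> m n e [_ ->].
- by move=> y m n q M B [X _ ->]; rewrite inE => /upd_other->.
- by move=> y m n e M [X _ ->]; rewrite inE => /upd_other->.
- move=> y z m n r M [L [U [_ _ ->]]]; rewrite !inE negb_or => /andP[? ?].
  by rewrite !upd_other.
- move=> y z m n M [Q [U [_ ->]]]; rewrite !inE negb_or => /andP[? ?].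
  by rewrite !upd_other.
- move=> y z t m n M [U [S [V [_ ->]]]]; rewrite !inE !negb_or => /and3P[? ? ?].
  by rewrite !upd_other.
- move=> y z t n M N [X [a [b [_ ->]]]]; rewrite !inE !negb_or => /and3P[? ? ?].
  by rewrite !upd_other.
Qed.

Lemma sound_do c p : 0%N \notin writes c -> sound p -> sound (Do c p).
Proof.
move=> c0 sp s f s0 [[s' cs o]|[]//]; apply: sp o.
by rewrite (step_frame cs c0).
Qed.

Lemma sound_any (X : eqType) (p : X -> prog) l :
  (forall x, sound (p x)) -> sound (any_of p l).
Proof.
move=> sp; elim: l => [|x l IH] s f s0 /=.
  case=> [[s' [/matrixP/(_ 0 0)/eqP + _]]|[]//].
  by rewrite !mxE rmorph1 oner_eq0.
by case=> [[_ /(sp x _ _ s0)]|[_ /(IH _ _ s0)]].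
Qed.

End Sound.

Definition agree b s s' : Prop := forall x, (x < b)%N -> s' x = s x.

Definition oc_block b k a e d (M : 'I_k -> expr a e) (cont : prog) : prog :=
  foldr (fun i : 'I_k => Do (OrthComplement (b + i)%N d (M i))) cont (enum 'I_k).

Lemma sound_block T R b k a e d (M : 'I_k -> expr a e) cont :
  (0 < b)%N -> sound T R cont -> sound T R (oc_block b d M cont).
Proof.
move=> b0 sc; rewrite /oc_block; elim: (enum _) => //= i l IH.
by apply: sound_do IH; rewrite inE; lia.
Qed.

(** The expressions are evaluated in stores already changed by the block, so their values may depend
    only on registers below [b]. *)
Lemma nofail_block b k a e d (M : 'I_k -> expr a e) (V : 'I_k -> 'M[F]_(a, e))
    cont s :
  (forall i s', agree b s s' -> eval s' (M i) = V i) ->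
  (forall i, \rank (V i) + d = a)%N ->
  (forall s', agree b s s' ->
     (forall i : 'I_k, is_orth_complement (V i) (s' (b + i)%N a d)) ->
     nofail cont s') ->
  nofail (oc_block b d M cont) s.
Proof.
move=> MV rV Hc; rewrite /oc_block.
suff H (l : seq 'I_k) s1 : uniq l -> agree b s s1 ->
    (forall i : 'I_k, i \notin l -> is_orth_complement (V i) (s1 (b + i)%N a d)) ->
    nofail (foldr (fun i : 'I_k => Do (OrthComplement (b + i)%N d (M i))) cont l) s1.
  by apply: H; rewrite ?enum_uniq // => i; rewrite mem_enum.
elim: l s1 => [|i l IH] s1 /=; first by move=> _ ag oc; apply: Hc => // i; apply: oc.
move=> /andP[il ul] ag oc; apply: nofail_do => /=.
  have [X XP] := orth_complement_ex (rV i).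
  by exists (upd s1 (b + i)%N X), X => //; rewrite MV.
move=> s' [X XP ->]; rewrite (MV i s1 ag) in XP; apply: IH => //.
  by move=> x xb; rewrite upd_other ?ag //; lia.
move=> j jl; have [->|ji] := eqVneq j i; first by rewrite upd_same.
rewrite upd_other; first by apply: oc; rewrite inE negb_or ji.
by rewrite eqn_add2l.
Qed.

End Programs.

(** * The algorithm, its exactness and its success *)

Section Algorithm.
Variables I J K R k : nat.
Local Notation m := (R - k + 2)%N.
Local Notation n := 'C(R.+1, m).
Local Notation d := 'C(R, m.-1).

(* Registers 2 and 3 hold the rank factorization, 4 the functionals, 5 the
   eigenvectors and 8 the estimated flats; from 9 on there are the left kernels
   of the contractions with the flats, then the columns of the third factor,
   then those of the first. *)
Definition tensor_e : expr (I * J) K := Reg 0 (I * J) K.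
Definition left_e : expr (I * J) k := Reg 2 (I * J) k.
Definition kernel_e : expr n d := Reg 4 n d.

Definition samples_e : expr ('C(I, m) * 'C(J, m)) n :=
  ecols (fun T =>
    evec (Compound m (unvec (Mul left_e (Const (col T (node_mx k R m))))))).

Definition moment_e t : expr 'C(R.+1, m.-1) d :=
  Mul (Const (node_values k R m *m diag_mx (weight_row k R m t))) kernel_e.

Definition estimates_e t : expr k d :=
  Mul (Mul (Const (node_mx k R m *m
                   diag_mx (\row_T weight_row k R m t 0 T ^+ m.-1))) kernel_e)
      (Reg 5 d d).

Definition flat_e (tau : {ffun 'I_d -> 'I_d}) (V : 'I_d) : expr k 1 :=
  ecol (tau V) (Reg 8 k d).

Definition third_e tau (r : 'I_R) : expr k k :=
  egram (fun V => r \notin kset V) (flat_e tau).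

Definition first_e (r : 'I_R) : expr I I :=
  egram (fun V : 'I_d => r \in kset V) (fun V => Reg (9 + V) I (I - m.-1)).

Definition factorA_e : expr I R := ecols (fun r => Reg (9 + d + R + r) I 1).

Definition factorC_e : expr K R :=
  ecols (fun r => Mul (tr (Reg 3 k K)) (Reg (9 + d + r) k 1)).

(** The unfolding along the second mode, in which the second factor is the unknown of a linear
    system. *)
Definition mode2_e : expr (I * K) J :=
  Gather (fun i j => (mxtens_index ((mxtens_unindex i).1, j),
                      (mxtens_unindex i).2)) tensor_e.

Definition solve_last : program I J K :=
  Do (Assign 1 factorA_e) (Do (Assign 2 factorC_e)
    (Do (Solve 4 (KhatriRao (Reg 1 I R) (Reg 2 K R)) mode2_e)
      (Return (Reg 1 I R) (tr (Reg 4 R J)) (Reg 2 K R)))).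

Definition recover_factors tau : program I J K :=
  oc_block 9 (I - m.-1) (fun V => unvec (Mul left_e (flat_e tau V)))
    (oc_block (9 + d) 1 (third_e tau)
      (oc_block (9 + d + R) 1 first_e solve_last)).

Definition pencil t1 t2 : program I J K :=
  Do (GEVD 5 6 7 (Mul (tr (moment_e t1)) (moment_e t1))
                 (Mul (tr (moment_e t1)) (moment_e t2)))
    (Do (Assign 8 (estimates_e t1))
      (any_of recover_factors (enum {ffun 'I_d -> 'I_d}))).

(* The bounds on [t1] and [t2] come from counting the roots of the polynomials
   in [t] that have to be avoided, see [weights_ex]. *)
Definition branch : program I J K :=
  Do (RankFactor 2 3 k tensor_e)
    (Do (OrthComplement 4 d (tr samples_e))
      (any_of (fun t1 => any_of (pencil t1) (iota 0 (d * d * k).+1))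
         (iota 0 (d * k).+1))).

Variable F : realType.
Variable T : tensor F I J K.

Lemma eval_mode2 (s : store F) i j l : s 0%N (I * J)%N K = unfolding T ->
  eval s mode2_e (mxtens_index (i, l)) j = T (i, j, l).
Proof.
move=> s0; transitivity (s 0%N (I * J)%N K (mxtens_index (i, j)) l).
  by rewrite [LHS]mxE mxtens_indexK.
by rewrite s0 mxE mxtens_indexK.
Qed.

Lemma mode2_polyadic (A : 'M[F]_(I, R)) (B : 'M_(J, R)) (C : 'M_(K, R))
    (s : store F) : s 0%N (I * J)%N K = unfolding T ->
  khatri_rao A C *m B^T = eval s mode2_e <-> T = polyadic A B C.
Proof.
move=> s0.
have KE i j l : (khatri_rao A C *m B^T) (mxtens_index (i, l)) j =
    polyadic A B C (i, j, l).
  rewrite mxE polyadicE; apply: eq_bigr => r _.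
  by rewrite [khatri_rao _ _ _ _]mxE mxtens_indexK [B^T _ _]mxE mulrAC.
split=> [E|TE].
  by apply/ffunP => -[[i j] l]; rewrite -KE E eval_mode2.
apply/matrixP => il j; case: (mxtens_indexP il) => i l.
by rewrite KE eval_mode2 // TE.
Qed.

(** The equation solved last is the decomposition itself, read in the second unfolding; no earlier
    instruction writes to register 0. *)
Lemma sound_branch : sound T R branch.
Proof.
do 2!apply: sound_do => //; do 2!(apply: sound_any => ?).
do 2!apply: sound_do => //; apply: sound_any => tau.
do 3!apply: sound_block => //.
do 2!apply: sound_do => //.
move=> s f s0 [[s' [X XE ->]]|[]//] [->]; split=> //.
apply/(mode2_polyadic _ _ _ s0); rewrite -XE /=.
have [-> ->] : upd s 4 X 1%N = s 1%N /\ upd s 4 X 2%N = s 2%N by rewrite !upd_other.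
by congr (_ *m _); apply/matrixP => i j; rewrite !mxE upd_same.
Qed.

Section Success.
Variables (A : 'M[F]_(I, R)) (B : 'M[F]_(J, R)) (C : 'M[F]_(K, R)).
Hypotheses (TE : T = polyadic A B C) (rC : \rank C = k) (k2 : (2 <= k)%N).
Hypotheses (kR : (k <= R)%N) (kC : krank C = k).
Hypothesis rK : \rank (khatri_rao (compound m A) (compound m B)) = 'C(R, m).

Lemma nofail_solve_last (s : store F) (a c : 'I_R -> F) :
  s 0%N (I * J)%N K = unfolding T ->
  (forall r, a r != 0) -> (forall r, c r != 0) ->
  (forall r : 'I_R, eval s (Reg (9 + d + R + r) I 1) = a r *: col r A) ->
  (forall r : 'I_R, eval s (Mul (tr (Reg 3 k K)) (Reg (9 + d + r) k 1)) = c r *: col r C) ->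
  nofail solve_last s.
Proof.
move=> s0 a0 c0 EA EC.
apply: nofail_do => [|s1 ->]; first by eexists.
apply: nofail_do => [|s2 ->]; first by eexists.
set s2' := upd _ 2 _.
have As : s2' 1%N I R = eval s factorA_e by rewrite /s2' upd_other // upd_same.
have Cs : s2' 2%N K R = eval s factorC_e.
  rewrite /s2' upd_same; apply/matrixP => i r.
  (* [factorC_e] is evaluated after register 1 has been overwritten, but reads only register 3 and
     registers from [9 + d] on. *)
  have eC r' : col r' (eval (upd s 1 (eval s factorA_e)) factorC_e) =
      col r' (eval s factorC_e).
    by rewrite !eval_ecols !eval_mul !eval_tr /= !upd_other //; lia.
  by have /colP/(_ i) := eC r; rewrite !mxE.
have Ar i r : eval s factorA_e i r = a r * A i r.
  have : col r (eval s factorA_e) = a r *: col r A by rewrite eval_ecols EA.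
  by move/colP/(_ i); rewrite !mxE.
have Cr i r : eval s factorC_e i r = c r * C i r.
  have : col r (eval s factorC_e) = c r *: col r C by rewrite eval_ecols EC.
  by move/colP/(_ i); rewrite !mxE.
have s20 : s2' 0%N (I * J)%N K = unfolding T by rewrite /s2' !upd_other.
apply: nofail_do => [|s3 _] //.
(* The second factor compensates the scalars of the computed columns of the other two. *)
pose B' : 'M[F]_(J, R) := \matrix_(j, r) (B j r / (a r * c r)).
eexists; exists B'^T => //; rewrite /= As Cs; apply/(mode2_polyadic _ _ _ s20).
rewrite TE; apply/ffunP => -[[i j] l]; rewrite !polyadicE; apply: eq_bigr => r _.
by rewrite Ar Cr mxE; field; rewrite a0 c0.
Qed.

Lemma nofail_branch (s : store F) : s 0%N (I * J)%N K = unfolding T -> nofail branch s.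
Proof.
move=> s0; have mk : (m + k = R.+2)%N by lia.
have [L0 [U0 E0]] : exists (L : 'M_(I * J, k)) (U : 'M_(k, K)), unfolding T = L *m U.
  by rewrite TE -rC; apply: (@compression_exists _ _ _ _ _ m _ B); rewrite ?rC.
have rT : \rank (unfolding T) = k.
  by rewrite TE -[RHS]rC; apply: (@rank_unfolding _ _ _ _ _ m); rewrite ?rC.
apply: nofail_do => [|s1 [L [U [_ LU ->]]]].
  by eexists; exists L0, U0; rewrite /= s0.
rewrite /= s0 in LU.
have Uf : row_free U.
  by rewrite /row_free eqn_leq rank_leq_row -{1}rT LU mxrankM_maxr.
have [C1 [LE CE]] : exists C1 : 'M_(k, R), L = khatri_rao A B *m C1^T /\ C = U^T *m C1.
  apply: compress Uf _; last by rewrite -LU TE unfolding_polyadic.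
  by apply: (kr_row_free _ rK); lia.
have Cgp : general_position C1 := compress_general_position kC CE.
set st1 := upd _ 3 _.
have s1L : st1 2%N (I * J)%N k = L by rewrite /st1 upd_other // upd_same.
have s1U : st1 3%N k K = U by rewrite /st1 upd_same.
have s10 : st1 0%N (I * J)%N K = unfolding T by rewrite /st1 !upd_other.
have [|rS ocS] := compound_samples Cgp k2 kR mk rK LE
    (_ : forall i, col i (eval st1 samples_e) = _).
  move=> i; rewrite eval_ecols eval_evec.
  rewrite eval_compound eval_unvec.
  by rewrite [eval _ left_e]s1L.
apply: nofail_do => [|s2 [Z]].
  have [Z ocZ] := orth_complement_ex rS.
  by eexists; exists Z; rewrite ?eval_tr.
rewrite eval_tr => /ocS[PZ Zf] ->.
have [beta bu Zb] := kernel_structure Cgp k2 kR mk PZ Zf.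
have [t1 [t2 [t1b t2b t1P t2P]]] := weights_ex Cgp k2 kR mk.
(* Suitable weights depend on the unknown [C1], but their bounds do not, so they occur in the lists
   that are tried. *)
apply: (@nofail_any _ _ _ _ _ _ _ t1); first by rewrite mem_iota; lia.
apply: (@nofail_any _ _ _ _ _ _ _ t2); first by rewrite mem_iota; lia.
set s2' := upd _ 4 _.
have mE t : eval s2' (moment_e t) = moment k Z t.
  by rewrite /moment_e /= /s2' upd_same.
have pE t t' : eval s2' (Mul (tr (moment_e t)) (moment_e t')) =
    (moment k Z t)^T *m moment k Z t'.
  by rewrite eval_mul eval_tr !mE.
have s2L : s2' 2%N (I * J)%N k = L by rewrite /s2' upd_other.
have s2U : s2' 3%N k K = U by rewrite /s2' upd_other.
have s20 : s2' 0%N (I * J)%N K = unfolding T by rewrite /s2' upd_other.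
apply: nofail_do => [|s3 [X [a [b]]]].
  have [X [a [b H]]] := gevd_ex Cgp k2 kR mk bu Zb t2 t1P.
  by eexists; exists X, a, b; split; first by rewrite !pE.
rewrite !pE => -[/(flat_estimatesP Cgp k2 kR mk bu Zb t1P t2P)].
move=> [tau tauP] ->.
set s3' := upd _ 7 _.
apply: nofail_do => [|s4 ->]; first by eexists.
have FE : eval s3' (estimates_e t1) = flat_estimates k Z t1 X.
  rewrite /estimates_e !eval_mul /= /s3'; congr (_ *m _ *m _).
    by rewrite !upd_other // /s2' upd_same.
  by rewrite upd_other // upd_other // upd_same.
rewrite FE; set st4 := upd s3' 8 _.
pose fh V := col (tau V) (flat_estimates k Z t1 X).
have fhP V : exists c, c != 0 /\ fh V = c *: cflat C1 V by apply: tauP.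
have s4L : st4 2%N (I * J)%N k = L by rewrite /st4 /s3' !upd_other.
have s4U : st4 3%N k K = U by rewrite /st4 /s3' !upd_other.
have s40 : st4 0%N (I * J)%N K = unfolding T by rewrite /st4 /s3' !upd_other.
have s4F (st : store F) V : agree 9 st4 st -> eval st (flat_e [ffun V => tau V] V) = fh V.
  by move=> ag; rewrite /flat_e eval_ecol ffunE /= ag // /st4 upd_same.
(* Which eigenvector belongs to which flat is unknown to the program; [tau] is one of the finitely
   many labellings tried. *)
apply: (@nofail_any _ _ _ _ _ _ _ [ffun V => tau V]); first by rewrite mem_enum.
apply: (@nofail_block _ _ _ _ _ _ _ _ _ _ (fun V => slice L (fh V))).
- move=> V st ag; rewrite eval_unvec s4F //.
  by congr slice; rewrite /left_e /= ag // s4L.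
- by move=> V; apply: (rank_slice Cgp k2 kR mk fhP rK LE).
move=> st5 ag5 ocN.
have third r := third_factor_gram Cgp k2 kR mk fhP
  (erefl (\sum_(V : 'I_d | r \notin kset V) fh V *m (fh V)^T)).
apply: (@nofail_block _ _ _ _ _ _ _ _ _ _
  (fun r => \sum_(V : 'I_d | r \notin kset V) fh V *m (fh V)^T)).
- move=> r st ag; rewrite eval_egram; apply: eq_bigr => V _.
  by rewrite s4F // => x x9; rewrite ag ?ag5 //; lia.
- by move=> r; have [] := third r.
move=> st6 ag6 ocC.
pose Nn (V : 'I_d) : 'M[F]_(I, I - m.-1) := st5 (9 + V)%N I (I - m.-1)%N.
have first r := first_factor_gram Cgp k2 kR mk fhP rK LE (r := r) ocN erefl.
apply: (@nofail_block _ _ _ _ _ _ _ _ _ _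
  (fun r => \sum_(V : 'I_d | r \in kset V) Nn V *m (Nn V)^T)).
- move=> r st ag; rewrite eval_egram; apply: eq_bigr => V _ /=.
  by have Vd := ltn_ord V; rewrite ag ?ag6 //; lia.
- by move=> r; have [] := first r.
move=> st7 ag7 ocA.
have /fin_all_exists[a' a'P] (r : 'I_R) : exists c, c != 0 /\
    st7 (9 + d + R + r)%N I 1%N = c *: col r A.
  by have [_] := first r; apply.
have /fin_all_exists[c' c'P] (r : 'I_R) : exists c, c != 0 /\
    st6 (9 + d + r)%N k 1%N = c *: col r C1.
  by have [_] := third r; apply.
apply: (@nofail_solve_last _ a' c').
- by rewrite ag7 ?ag6 ?ag5 ?s40.
- by move=> r; have [] := a'P r.
- by move=> r; have [] := c'P r.
- by move=> r; have [_ <-] := a'P r.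
move=> r; rewrite eval_mul eval_tr /= ag7 ?ag6 ?ag5 // s4U.
rewrite ag7; last by have := ltn_ord r; lia.
have [_ ->] := c'P r; rewrite -scalemxAr; congr (_ *: _).
by rewrite CE !colE mulmxA.
Qed.
End Success.
End Algorithm.

(** Minimality of the rank excludes fewer than [R] terms. *)
Lemma nterms_cpd (F : realType) (I J K : nat) (T : tensor F I J K) R (f : factors F I J K) :
  has_rank T R -> (nterms f <= R)%N ->
  T = polyadic (factorA f) (factorB f) (factorC f) ->
  is_cpd T (factorA f) (factorB f) (factorC f).
Proof.
move=> rT fR TE; apply: is_cpd_polyadic => //.
suff -> : nterms f = R by [].
apply/eqP; rewrite eqn_leq fR /=.
have := polyadic_sum_of_rank1 (factorA f) (factorB f) (factorC f).
rewrite -TE => /rT.2/leq_trans-> //.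
by rewrite -[leqRHS]card_ord max_card.
Qed.

Theorem theorem1p6 (F : realType) (I J K : nat) :
  exists P : procedure I J K,
    forall (R : nat)
      (A : 'M[F]_(I, R)) (B : 'M[F]_(J, R)) (C : 'M[F]_(K, R)),
    let T := polyadic A B C in
    let m := (R - \rank C + 2)%N in
    (m <= minn I R)%N -> (m <= minn J R)%N ->
    krank C = \rank C ->
    \rank (khatri_rao (compound m A) (compound m B)) = 'C(R, m) ->
    (has_rank T R /\ cpd_unique T) /\ finds_cpd P T.
Proof.
(* The number of terms is increased until a branch succeeds, so that the
   decomposition found has at most [R] terms. *)
pose search R := any_of (@branch I J K R) (iota 0 K.+1).
exists (Procedure 0 (any_of search (iota 0 (I + K).+1))).
move=> R A B C T m mI mJ kC rK.
have rCR : (\rank C <= R)%N := rank_leq_col C.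
have rCK : (\rank C <= K)%N := rank_leq_row C.
(* The hypothesis [m <= R] excludes ranks 0 and 1. *)
have k2 : (2 <= \rank C)%N by rewrite /m in mI; lia.
have mk : (m + \rank C = R.+2)%N by rewrite /m; lia.
have rT : has_rank T R := has_rank_polyadic k2 rCR mk kC rK.
split; first by split=> //; apply: cpd_unique_polyadic k2 rCR mk kC rK.
exists 1; first exact: oner_neq0.
move=> w _; split; first exact: outcome_ex.
move=> o; have s0 : init T w 0%N (I * J)%N K = unfolding T.
  by rewrite /init upd_other // upd_same.
have nf : nofail (search R) (init T w).
  apply: (@nofail_any _ _ _ _ _ _ _ (\rank C)); first by rewrite mem_iota; lia.
  exact: (nofail_branch (erefl T)).
(* The search reaches [R = m + \rank C - 2] because [m <= I] and [\rank C <= K]. *)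
case/(any_of_outcome (_ : (0 <= R < 0 + (I + K).+1)%N) nf); first by rewrite /m in mI; lia.
move=> R' [f [R'R -> oR']]; exists f => //.
have [|fR TE] := @sound_any F I J K T R' _ (@branch I J K R') (iota 0 K.+1) _ _ f s0 oR'.
  by move=> k; apply: sound_branch.
by apply: (nterms_cpd rT) => //; rewrite fR.
Qed.
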